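(* Let $n\in\mathbb{N}$ and consider the time-varying single-output triangular system $$\dot{x}_i=f_i(t,x_1,\ldots,x_{i+1}),\quad i=1,\ldots,n-1,\qquad \dot{x}_n=f_n(t,x_1,\ldots,x_n),\qquad y=x_1,\qquad(\Sigma)$$ with state $x=(x_1,\ldots,x_n)\in\mathbb{R}^n$ and output $y\in\mathbb{R}$, where $f_i:\mathbb{R}_{\ge 0}\times\mathbb{R}^{i+1}\to\mathbb{R}$ ($i=1,\ldots,n-1$) and $f_n:\mathbb{R}_{\ge 0}\times\mathbb{R}^{n}\to\mathbb{R}$ are continuous and locally Lipschitz in the state variables (uniformly for $t$ in compact sets). Assume that: (a) for each $i=1,\ldots,n-1$ and each $(t;x_1,\ldots,x_i)\in\mathbb{R}_{\ge 0}\times\mathbb{R}^i$, the function $\mathbb{R}\ni z\mapsto f_i(t,x_1,\ldots,x_i,z)\in\mathbb{R}$ is strictly monotone; (b) $(\Sigma)$ is forward complete, i.e. there exists a function $\beta\in NN$ such that for all $t_0\ge 0$ and $x_0\in\mathbb{R}^n$ the solution $x(\cdot)=x(\cdot,t_0,x_0)$ of the state equations of $(\Sigma)$ with $x(t_0)=x_0$ satisfies $$|x(t)|\le\beta(t,|x_0|)\quad\text{for all } t\ge t_0 .$$ Then: (i) the Switching Observer Design Problem (SODP) is solvable for $(\Sigma)$ with respect to $\mathbb{R}^n$; (ii) if in addition it is a priori known that the initial states of $(\Sigma)$ belong to a given ball $B_R$ of radius $R>0$ centered at $0\in\mathbb{R}^n$, then the Observer Design Problem (ODP) is solvable for $(\Sigma)$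 with respect to $B_R$.
   Context: Notation. $|\cdot|$ is the Euclidean norm; $B_R$ is the closed ball of radius $R>0$ centered at $0\in\mathbb{R}^n$. $N$ is the class of all increasing continuous functions $\phi:\mathbb{R}_{\ge 0}\to\mathbb{R}_{\ge 0}$. $NN$ is the class of continuous functions $\beta:\mathbb{R}_{\ge 0}\times\mathbb{R}_{\ge 0}\to\mathbb{R}_{\ge 0}$ such that $\beta(\cdot,s)\in N$ and $\beta(s,\cdot)\in N$ for every $s\ge 0$. General setting for the definitions. Consider a forward complete system $\dot{x}=f(t,x)$, $(t,x)\in\mathbb{R}_{\ge 0}\times\mathbb{R}^n$, with output $y=h(t,x)\in\mathbb{R}^{\bar n}$, and let $x(\cdot,t_0,x_0)$ denote its solution with $x(t_0)=x_0$. (For the triangular system, $\bar n=1$ and $h(t,x)=x_1$.) For $t_0\ge 0$ and nonempty $M\subset\mathbb{R}^n$, the set of outputs is $$O(t_0,M):=\{y:[t_0,\infty)\to\mathbb{R}^{\bar n}\ :\ y(t)=h(t,x(t,t_0,x_0)),\ t\ge t_0,\ \text{for some } x_0\in M\}.$$ ODP. The Observer Design Problem is solvable for the system with respect to $M$ if for every $t_0\ge 0$ there exist a continuous map $G=G_{t_0}(t,z,w):[t_0,\infty)\times\mathbb{R}^n\times\mathbb{R}^{\bar n}\to\mathbb{R}^n$ and a nonempty set $\bar M\subset\mathbb{R}^n$ such that for every $z_0\in\bar M$ and every output $y\in O(t_0,M)$ the corresponding trajectory $z(\cdot)=z(\cdot,t_0,z_0;y)$, $z(t_0)=z_0$, of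 the observer $\dot z=G(t,z,y(t))$ exists for all $t\ge t_0$, and the error $e(\cdot):=x(\cdot)-z(\cdot)$ between the trajectory $x(\cdot)=x(\cdot,t_0,x_0)$, $x_0\in M$, of the system (whose output is $y$) and the observer trajectory satisfies $\lim_{t\to\infty}e(t)=0$. SODP. The Switching Observer Design Problem is solvable for the system with respect to $M$ if for every $t_0\ge 0$ there exist - a strictly increasing sequence of times $(t_k)_{k\in\mathbb{N}}$, $\mathbb{N}=\{1,2,\ldots\}$, with $t_1=t_0$ and $\lim_{k\to\infty}t_k=\infty$, - a sequence of continuous maps $G_k=G_{k,t_{k-1}}(t,z,w):[t_{k-1},t_{k+1}]\times\mathbb{R}^n\times\mathbb{R}^{\bar n}\to\mathbb{R}^n$, $k\in\mathbb{N}$, and - a nonempty set $\bar M\subset\mathbb{R}^n$, such that for every output $y\in O(t_0,M)$ the solution $z_k(\cdot)$ of $$\dot z_k=G_k(t,z_k,y(t)),\quad t\in[t_{k-1},t_{k+1}],$$ with initial value $z_k(t_{k-1})\in\bar M$, is defined for every $t\in[t_{k-1},t_{k+1}]$, and such that, defining the piecewise continuous map $Z:[t_0,\infty)\to\mathbb{R}^n$ by $Z(t):=z_k(t)$ for $t\in[t_k,t_{k+1})$, $k\in\mathbb{N}$, the error $e(\cdot):=x(\cdot)-Z(\cdot)$ between the trajectory $x(\cdot)=x(\cdot,t_0,x_0)$, $x_0\in M$, of the system (whose output is $y$) and $Z(\cdot)$ satisfies $\lim_{t\to\infty}e(t)=0$. *)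

(* Defs.v *)
From HB Require Import structures.
From mathcomp Require Import all_boot all_order all_algebra.
From mathcomp Require Import all_classical all_reals all_analysis.

Set Implicit Arguments.
Unset Strict Implicit.
Unset Printing Implicit Defensive.

Import Order.TTheory GRing.Theory Num.Theory.
Import numFieldNormedType.Exports.

Local Open Scope classical_set_scope.
Local Open Scope ring_scope.

(* The library norm on 'rV[R]_n is the sup norm, hence a separate Euclidean
   norm; the two induce the same topology and the same (locally) Lipschitz
   functions. *)
Definition enorm (R : realType) (n : nat) (x : 'rV[R]_n) : R :=
  Num.sqrt (\sum_(i < n) x ord0 i ^+ 2).

Definition eball (R : realType) (n : nat) (r : R) : set 'rV[R]_n :=
  [set x | enorm x <= r].

(* Functions on a part of R (half-lines, compact intervals) are total
   functions of which only the values on that part are constrained or used. *)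

(* "Increasing" is read in the wide sense. For the existence of a bound
   beta in NN both readings agree: beta t s + t + s is strictly increasing
   in each variable. *)
Definition classN (R : realType) (phi : R -> R) : Prop :=
  [/\ {within `[0, +oo[%classic, continuous phi},
      forall s, 0 <= s -> 0 <= phi s
    & forall s1 s2, 0 <= s1 -> s1 <= s2 -> phi s1 <= phi s2].

Definition classNN (R : realType) (beta : R -> R -> R) : Prop :=
  [/\ {within [set p : R * R | 0 <= p.1 /\ 0 <= p.2],
         continuous (fun p : R * R => beta p.1 p.2)},
      forall s, 0 <= s -> classN (beta ^~ s)
    & forall s, 0 <= s -> classN (beta s)].

Definition strictly_monotone (R : realType) (g : R -> R) : Prop :=
  (forall a b, a < b -> g a < g b) \/ (forall a b, a < b -> g b < g a).

Definition jointly_continuous (R : realType) (n : nat)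
    (f : R -> 'rV[R]_n -> R) : Prop :=
  {within [set p : R * 'rV[R]_n | 0 <= p.1],
     continuous (fun p : R * 'rV[R]_n => f p.1 p.2)}.

Definition locally_lipschitz_state (R : realType) (n : nat)
    (f : R -> 'rV[R]_n -> R) : Prop :=
  forall I : set R, compact I -> I `<=` `[0, +oo[%classic ->
  forall x : 'rV[R]_n, exists2 U : set 'rV[R]_n, nbhs x U &
  exists L : R, forall t, I t -> L.-lipschitz_U (f t).

(* Classical solutions of x' = F(t, x) on an interval D. When F is continuous,
   the equation also holds at the endpoints of D, with one-sided
   derivatives. *)
Definition solution_on (R : realType) (n : nat) (D : set R)
    (F : R -> 'rV[R]_n -> 'rV[R]_n) (x : R -> 'rV[R]_n) : Prop :=
  {within D, continuous x} /\
  forall t, D° t -> is_derive t (1 : R) x (F t (x t)).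

Definition trajectory (R : realType) (n : nat)
    (F : R -> 'rV[R]_n -> 'rV[R]_n) (t0 : R) (x0 : 'rV[R]_n)
    (x : R -> 'rV[R]_n) : Prop :=
  solution_on `[t0, +oo[%classic F x /\ x t0 = x0.

Definition forward_complete (R : realType) (n : nat)
    (F : R -> 'rV[R]_n -> 'rV[R]_n) : Prop :=
  exists2 beta : R -> R -> R, classNN beta &
  forall (t0 : R) (x0 : 'rV[R]_n), 0 <= t0 ->
    (exists x, trajectory F t0 x0 x) /\
    (forall x, trajectory F t0 x0 x ->
       forall t, t0 <= t -> enorm (x t) <= beta t (enorm x0)).

Definition output_of (R : realType) (n p : nat)
    (h : R -> 'rV[R]_n -> 'rV[R]_p) (t0 : R)
    (x : R -> 'rV[R]_n) (y : R -> 'rV[R]_p) : Prop :=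
  forall t, t0 <= t -> y t = h t (x t).

Definition outputs (R : realType) (n p : nat)
    (F : R -> 'rV[R]_n -> 'rV[R]_n) (h : R -> 'rV[R]_n -> 'rV[R]_p)
    (t0 : R) (M : set 'rV[R]_n) : set (R -> 'rV[R]_p) :=
  [set y | exists x0 x, [/\ M x0, trajectory F t0 x0 x & output_of h t0 x y]].

Definition observer_continuous (R : realType) (n p : nat) (D : set R)
    (G : R -> 'rV[R]_n -> 'rV[R]_p -> 'rV[R]_n) : Prop :=
  {within [set q : R * 'rV[R]_n * 'rV[R]_p | D q.1.1],
     continuous (fun q : R * 'rV[R]_n * 'rV[R]_p => G q.1.1 q.1.2 q.2)}.

(* An observer map is only required to be continuous, so that its trajectories
   need not be unique: below, one is required to exist for each admissible
   initial value, and the convergence is required of all of them. *)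
Definition ODP (R : realType) (n p : nat)
    (F : R -> 'rV[R]_n -> 'rV[R]_n) (h : R -> 'rV[R]_n -> 'rV[R]_p)
    (M : set 'rV[R]_n) : Prop :=
  forall t0 : R, 0 <= t0 ->
  exists (G : R -> 'rV[R]_n -> 'rV[R]_p -> 'rV[R]_n) (Mbar : set 'rV[R]_n),
  [/\ observer_continuous `[t0, +oo[%classic G,
      Mbar !=set0
    & forall z0 y, Mbar z0 -> outputs F h t0 M y ->
        let obs := fun t z => G t z (y t) in
        (exists z, trajectory obs t0 z0 z) /\
        (forall z, trajectory obs t0 z0 z ->
         forall x0 x, M x0 -> trajectory F t0 x0 x -> output_of h t0 x y ->
         (fun t => x t - z t) @ +oo --> (0 : 'rV[R]_n))].

(* The switching times are [tau 1 < tau 2 < ...], with [tau 1 = t0]; the index 0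
   stands for the initial time t0 itself, so that the first observer runs on
   [tau 0, tau 2] = [t0, tau 2]. The maps [G 0] and [z 0] are not used. *)
Definition SODP (R : realType) (n p : nat)
    (F : R -> 'rV[R]_n -> 'rV[R]_n) (h : R -> 'rV[R]_n -> 'rV[R]_p)
    (M : set 'rV[R]_n) : Prop :=
  forall t0 : R, 0 <= t0 ->
  exists (tau : nat -> R) (G : nat -> R -> 'rV[R]_n -> 'rV[R]_p -> 'rV[R]_n)
    (Mbar : set 'rV[R]_n),
  let D k := `[tau k.-1, tau k.+1]%classic in
  [/\ [/\ tau 0%N = t0, tau 1%N = t0,
          forall k, (1 <= k)%N -> tau k < tau k.+1
        & tau k @[k --> \oo] --> +oo],
      forall k, (1 <= k)%N -> observer_continuous (D k) (G k),
      Mbar !=set0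
    & forall y, outputs F h t0 M y ->
        let obs k := fun t z => G k t z (y t) in
        (forall k z0, (1 <= k)%N -> Mbar z0 ->
           exists2 z, solution_on (D k) (obs k) z & z (tau k.-1) = z0) /\
        (forall z : nat -> R -> 'rV[R]_n,
         (forall k, (1 <= k)%N ->
            solution_on (D k) (obs k) (z k) /\ Mbar (z k (tau k.-1))) ->
         forall Z : R -> 'rV[R]_n,
         (forall k t, (1 <= k)%N -> tau k <= t < tau k.+1 -> Z t = z k t) ->
         forall x0 x, M x0 -> trajectory F t0 x0 x -> output_of h t0 x y ->
         (fun t => x t - Z t) @ +oo --> (0 : 'rV[R]_n))].

(* The first k+2 coordinates of a vector of dimension m+1, for k < m. *)
Lemma head_subproof (m : nat) (i : 'I_m) : (i.+1 + 1 <= m.+1)%N.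
Proof. by rewrite addn1 ltnS. Qed.

Definition head_coords (R : realType) (m : nat) (i : 'I_m) (x : 'rV[R]_m.+1) :
    'rV[R]_(i.+1 + 1) :=
  \row_j x ord0 (widen_ord (head_subproof i) j).

(* State space of dimension m+1, coordinates numbered from 0: for i < m,
   coordinate i evolves by [f i], a function of the coordinates 0, ..., i+1;
   coordinate m evolves by [fn]. *)
Definition triangular_field (R : realType) (m : nat)
    (f : forall i : 'I_m, R -> 'rV[R]_(i.+1 + 1) -> R)
    (fn : R -> 'rV[R]_m.+1 -> R) (t : R) (x : 'rV[R]_m.+1) : 'rV[R]_m.+1 :=
  \row_(i < m.+1)
    if insub (i : nat) is Some j then f j t (head_coords j x) else fn t x.

Definition first_coord (R : realType) (m : nat) (t : R) (x : 'rV[R]_m.+1) :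
    'rV[R]_1 :=
  \row_(_ < 1) x ord0 ord0.

(* Main.v *)
(* Integrate dirty derivatives in cascade. Trajectories starting in a ball stay
   in a box [|x| <= B t] known in advance. If [xh] estimates [x_k], the linear
   filter [z' = (xh - z) / th t] with slowly decreasing time constant [th] makes
   [w = (xh - z) / th] an estimate of [x_k' = f_k(t, x_0, ..., x_(k+1))], and the
   strict monotonicity of [f_k] in its last argument recovers from [w] an
   estimate of [x_(k+1)]: the root, clamped to [[- B t, B t]], of an increasing
   function of [x_(k+1)], which depends continuously on all data. Each stage
   needs one unit of time. By compactness, any positive nonincreasing precision
   at stage [k + 1] is guaranteed by such a precision at stage [k], so the time
   constants are chosen backwards, from the last stage to the first; at stage 0
   the estimate is the output itself. This solves the observer design problem
   over a ball. For the switching problem, the [k]-th observer is the one for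
   the ball of radius [k], started early enough to be accurate when it is used. *)
Require Import Defs.
From HB Require Import structures.
From mathcomp Require Import all_boot all_order all_algebra.
From mathcomp Require Import all_classical all_reals all_analysis.
From mathcomp Require Import ring lra.

Set Implicit Arguments.
Unset Strict Implicit.
Unset Printing Implicit Defensive.

Import Order.TTheory GRing.Theory Num.Theory.
Import numFieldNormedType.Exports.

Local Open Scope classical_set_scope.
Local Open Scope ring_scope.

(** * Differential inequalities and scalar linear equations *)

Lemma continuous_comp_within (T U V : topologicalType) (A : set U)
    (c : T -> U) (u : U -> V) :
  {within A, continuous u} -> continuous c -> (forall t, A (c t)) ->
  continuous (u \o c).
Proof.
move=> /subspace_continuousP uA cc Ac t; apply: cvg_trans (uA _ (Ac t)).
move=> B uB; have cuB : \forall s \near t, A (c s) -> B (u (c s)) := cc t _ uB.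
by apply: filterS cuB => s; apply.
Qed.

Section ode.
Context {R : realType}.
Implicit Types (s t T : R) (f g u a b q : R -> R).

(** Projecting the argument onto the segment gives a function continuous on the whole line, under
    which preimages of closed sets are closed. *)
Lemma continuous_clamp_itv (V : topologicalType) s T (u : R -> V) : s <= T ->
  {within `[s, T], continuous u} ->
  continuous (fun t => u (Num.max s (Num.min t T))).
Proof.
move=> sT uc.
apply: (@continuous_comp_within R R V _ (fun t => Num.max s (Num.min t T)) _ uc).
  move=> t; apply: (@continuous_max R R (cst s) (fun t => Num.min t T)).
    exact: cst_continuous.
  apply: (@continuous_min R R id (cst T)); [exact: cvg_id|exact: cst_continuous].
by move=> t /=; rewrite in_itv/= le_max lexx ge_max ge_min sT lexx orbT.
Qed.

Lemma continuous_clamp_infty (V : topologicalType) s (u : R -> V) :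
  {within `[s, +oo[, continuous u} -> continuous (fun t => u (Num.max s t)).
Proof.
move=> uc; apply: (@continuous_comp_within R R V _ (Num.max s) _ uc).
  move=> t; apply: (@continuous_max R R (cst s) id).
    exact: cst_continuous.
  exact: cvg_id.
by move=> t /=; rewrite in_itv/= le_max lexx.
Qed.

(** After the last time [r] with [u r <= 0], [u] is positive; if [r < T], the mean value theorem on
    [[r, T]] bounds [u T] by [u r]. *)
Lemma le0_of_derive_le0_pos s T u u' : s <= T ->
  {within `[s, T], continuous u} ->
  (forall t, s < t < T -> is_derive t 1 u (u' t)) ->
  (forall t, s < t < T -> 0 < u t -> u' t <= 0) ->
  u s <= 0 -> u T <= 0.
Proof.
move=> sT uc du du0 us0; rewrite leNgt; apply/negP => uT.
pose v t := u (Num.max s (Num.min t T)).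
have vc : continuous v := continuous_clamp_itv sT uc.
have vu t : s <= t <= T -> v t = u t.
  by move=> /andP[st tT]; rewrite /v min_l// max_r.
pose S := `[s, T]%classic `&` v @^-1` [set x | x <= 0].
have cS : closed S.
  by apply: closedI; [exact: interval_closed|apply: closed_comp => //; exact: closed_le].
have S0 : S s by split; rewrite /= ?in_itv/= ?lexx ?sT// vu ?lexx.
have ubS : has_ubound S by exists T => t [/=]; rewrite in_itv/= => /andP[].
have : S (sup S) by apply: cS; apply: closure_sup => //; exists s.
move: (sup S) (@ub_le_sup _ _ ubS) => r ler [/=]; rewrite in_itv/= => srT.
rewrite vu// => ur0; have [sr rT] := andP srT.
have {}rT : r < T.
  by rewrite lt_neqAle rT andbT; apply: contraTneq uT => <-; rewrite -leNgt.
have [||c] := @MVT _ u u' r T rT.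
- move=> t; rewrite in_itv/= => /andP[rt tT]; apply: du.
  by rewrite (le_lt_trans sr rt).
- apply: continuous_subspaceW uc => t /=; rewrite !in_itv/= => /andP[rt ->].
  by rewrite (le_trans sr rt).
- rewrite in_itv/= => /andP[rc cT] uE.
  have sc : s < c by exact: le_lt_trans rc.
  have uc0 : 0 < u c.
    rewrite ltNge; apply/negP => uc0; move: rc; rewrite ltNge ler//.
    by split; rewrite /= ?in_itv/= ?(ltW sc) ?(ltW cT)// vu ?(ltW sc) ?(ltW cT).
  have : u T - u r <= 0.
    by rewrite uE mulr_le0_ge0 ?subr_ge0 ?(ltW rT)// du0// sc cT.
  by rewrite subr_le0 => /(lt_le_trans uT)/lt_le_trans/(_ ur0); rewrite ltxx.
Qed.

Lemma is_derive1_continuous t f df : is_derive t 1 f df -> {for t, continuous f}.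
Proof. by case=> /derivable1_diffP /differentiable_continuous. Qed.

Lemma is_derive1D t f g df dg : is_derive t 1 f df -> is_derive t 1 g dg ->
  is_derive t 1 (fun t => f t + g t) (df + dg).
Proof. exact: is_deriveD. Qed.

Lemma is_derive1B t f g df dg : is_derive t 1 f df -> is_derive t 1 g dg ->
  is_derive t 1 (fun t => f t - g t) (df - dg).
Proof. exact: is_deriveB. Qed.

Lemma is_derive1M t f g df dg : is_derive t 1 f df -> is_derive t 1 g dg ->
  is_derive t 1 (fun t => f t * g t) (df * g t + f t * dg).
Proof.
move=> ft gt; apply: (is_derive_eq (@is_deriveM _ _ f g t 1 df dg ft gt)).
by rewrite /GRing.scale/= addrC mulrC.
Qed.

Lemma is_derive1_expR t f df : is_derive t 1 f df ->
  is_derive t 1 (fun t => expR (f t)) (df * expR (f t)).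
Proof.
move=> ft; apply: (is_derive_eq (@is_derive1_comp _ expR f t _ _ _ ft)).
by rewrite mulrC.
Qed.

Lemma is_derive1V t f df : f t != 0 -> is_derive t 1 f df ->
  is_derive t 1 (fun t => (f t)^-1) (- df / f t ^+ 2).
Proof.
move=> ft0 ft; apply: (is_derive_eq (@is_deriveV _ f t df 1 ft0 ft)).
by rewrite /GRing.scale/= mulNr mulNr mulrC.
Qed.

Lemma is_derive1_affine t k l : is_derive t 1 (fun t => k * (t - l)) k.
Proof.
have dl : is_derive t 1 (fun t => t - l) (1 - 0) by exact: is_derive1B.
by apply: (is_derive_eq (is_derive1M (is_derive_cst k t 1) dl)); rewrite /cst; ring.
Qed.

(** Comparison with the supersolution [r + e t], where [e] decays at rate [c]: wherever [q] exceeds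
    it, [a * q >= r * a + c * e >= b + c * e], so the difference does not grow. *)
Let linear_ode_upper s T q a b c r : s <= T ->
  {within `[s, T], continuous q} ->
  (forall t, s < t < T -> is_derive t 1 q (- a t * q t + b t)) ->
  (forall t, s < t < T -> `|b t| <= r * a t) ->
  0 <= c -> (forall t, s < t < T -> c <= a t) -> 0 <= r ->
  q T <= r + `|q s| * expR (- c * (T - s)).
Proof.
move=> sT qc dq br c0 ca r0.
pose e t := `|q s| * expR (- c * (t - s)).
have e0 t : 0 <= e t by rewrite mulr_ge0 ?expR_ge0.
have de t : is_derive t 1 e (- c * e t).
  apply: (is_derive_eq (is_derive1M (is_derive_cst `|q s| t 1)
    (is_derive1_expR (is_derive1_affine t (- c) s)))).
  by rewrite /e /cst; ring.
pose u t := q t - (r + e t).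
suff : u T <= 0 by rewrite /u /e; lra.
apply: (@le0_of_derive_le0_pos s T u
  (fun t => (- a t * q t + b t) - (0 + - c * e t))) => //.
- apply: within_continuousB => //; apply: continuous_subspaceT => t.
  by apply: is_derive1_continuous; exact: (is_derive1D (is_derive_cst r t 1) (de t)).
- move=> t stT.
  exact: (is_derive1B (dq t stT) (is_derive1D (is_derive_cst r t 1) (de t))).
- move=> t stT; rewrite /u subr_gt0 => reqt.
  have := br t stT; rewrite ler_norml => /andP[_ brt].
  have := ca t stT => cat.
  have : a t * (r + e t) <= a t * q t by rewrite ler_wpM2l ?(ltW reqt)// (le_trans c0).
  have : c * e t <= a t * e t by rewrite ler_wpM2r.
  lra.
- rewrite /u /e subrr mulr0 expR0 mulr1; have := ler_norm (q s); lra.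
Qed.

(** Two uses: a positive [c] makes the initial value forgotten exponentially fast; [c = 0] with
    [q s = 0] confines the solution to [[- r, r]]. The lower bound is the upper one for [- q]. *)
Lemma linear_ode_bound s T q a b c r : s <= T ->
  {within `[s, T], continuous q} ->
  (forall t, s < t < T -> is_derive t 1 q (- a t * q t + b t)) ->
  (forall t, s < t < T -> `|b t| <= r * a t) ->
  0 <= c -> (forall t, s < t < T -> c <= a t) -> 0 <= r ->
  `|q T| <= r + `|q s| * expR (- c * (T - s)).
Proof.
move=> sT qc dq br c0 ca r0; rewrite ler_norml; apply/andP; split; last first.
  exact: (@linear_ode_upper s T q a b).
rewrite lerNl -[`|q s|]normrN.
apply: (@linear_ode_upper s T (fun t => - q t) a (fun t => - b t)) => //.
- by move=> t; apply: cvgN; exact: qc.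
- move=> t stT; apply: (is_derive_eq (is_deriveN (dq t stT))); ring.
- by move=> t stT; rewrite normrN br.
Qed.

End ode.

(** * Time scales and tolerances *)

Section slow_scale.
Context {R : realType}.
Implicit Types (s t T : R) (a b p : R -> R).

Lemma antiderivative a : continuous a ->
  exists A : R -> R, forall t, 0 <= t -> is_derive t 1 A (a t).
Proof.
move=> ca.
(* The integral starts at [-1] so that every [t >= 0], including [0], is interior and has a
   two-sided derivative. *)
exists (fun t => \int[lebesgue_measure]_(x in `[-1, t]) a x)%R => t t0.
have tt1 : t < t + 1 by rewrite ltrDl.
have it : lebesgue_measure.-integrable `[-1, t + 1] (EFin \o a).
  apply: continuous_compact_integrable; first exact: segment_compact.
  exact: continuous_subspaceT.
have t1 : -1 < t by rewrite (lt_le_trans _ t0)// oppr_lt0.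
have [dA eA] := continuous_FTC1_closed tt1 it t1 (ca t).
by apply: DeriveDef; rewrite // -derive1E.
Qed.

(** Variation of constants, with an antiderivative [A] of [a] and an antiderivative [C] of
    [b * expR A]. *)
Lemma linear_ode_exists a b s z0 : 0 <= s -> continuous a -> continuous b ->
  exists2 z : R -> R, z s = z0 &
  forall t, 0 <= t -> is_derive t 1 z (- a t * z t + b t).
Proof.
move=> s0 ca cb; have [A dA] := antiderivative ca.
(* [A] is controlled on [[0, +oo[] only; freezing it at negative times makes the next integrand
   continuous on the whole line. *)
have cA : continuous (fun t => A (Num.max 0 t)).
  move=> t; apply: (@continuous_comp R R R (Num.max 0) A).
    apply: (@continuous_max R R (cst 0) id); first exact: cst_continuous.
    exact: cvg_id.
  by apply: (is_derive1_continuous (dA _ _)); rewrite le_max lexx.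
have [|C dC] := @antiderivative (fun t => b t * expR (A (Num.max 0 t))).
  move=> t; apply: cvgM; first exact: cb.
  by apply: (@continuous_comp R R R (fun t => A (Num.max 0 t)) expR);
    [exact: cA|exact: continuous_expR].
exists (fun t => expR (- A t) * (C t + (z0 * expR (A s) - C s))).
  by rewrite addrC subrK mulrCA -expRD addNr expR0 mulr1.
move=> t t0; have := dC t t0; rewrite max_r// => {}dC.
have dNA := is_derive1_expR (is_deriveN (dA t t0)).
have dC' := is_derive1D dC (is_derive_cst (z0 * expR (A s) - C s) t 1).
apply: (is_derive_eq (is_derive1M dNA dC')); rewrite /cst.
have : expR (- A t) * expR (A t) = 1 by rewrite -expRD addNr expR0.
by set e := expR (- A t); set e' := expR (A t) => ee'; rewrite addr0 mulrCA ee'; ring.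
Qed.

(** The infimal convolution of [p] with the absolute value is 1-Lipschitz, and inherits positivity
    and monotonicity from [p]. *)
Lemma pos_noninc_lipschitz_minorant p :
  (forall t, 0 < p t) -> (forall s t, s <= t -> p t <= p s) ->
  exists l : R -> R, [/\ forall t, 0 < l t, forall s t, s <= t -> l t <= l s,
    forall t, l t <= p t & continuous l].
Proof.
move=> p0 pn.
pose S t := [set p s + `|t - s| | s in [set: R]].
have S0 t : S t !=set0 by exists (p t + `|t - t|), t.
have lbS t : has_lbound (S t).
  by exists 0 => _ [s _ <-]; rewrite addr_ge0// ltW.
pose l t := inf (S t).
have lle t s : l t <= p s + `|t - s| by apply: ge_inf => //; exists s.
have lge t c : (forall s, c <= p s + `|t - s|) -> c <= l t.
  by move=> cS; apply: lb_le_inf => // _ [s _ <-].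
have ll s t : l t <= l s + `|t - s|.
  rewrite -lerBlDr; apply: lge => r; have := lle t r.
  have := ler_distD s t r; lra.
exists l; split.
(* A point [s <= t + 1] contributes at least [p (t + 1)]; a point beyond contributes a distance
   larger than [1]. *)
- move=> t; apply: (@lt_le_trans _ _ (Num.min (p (t + 1)) 1)).
    by rewrite lt_min p0 ltr01.
  apply: lge => s; have [st|ts] := leP s (t + 1).
    by rewrite ge_min (le_trans (pn _ _ st))// lerDl.
  rewrite ge_min orbC; apply/orP; left.
  have := p0 s; have := ler_norm (s - t); rewrite (distrC s t); lra.
(* Translating the competitor [r] by [t - s] keeps the distance and does not increase [p]. *)
- move=> s t st; apply: lge => r; have := lle t (r + (t - s)).
  have -> : t - (r + (t - s)) = s - r by ring.
  have : p (r + (t - s)) <= p r by apply: pn; lra.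
  lra.
- by move=> t; have := lle t t; rewrite subrr normr0 addr0.
- move=> t; apply/cvgrPdist_le => e e0; near=> s.
  have tse : `|t - s| <= e by near: s; exact: cvgr_dist_le.
  rewrite ler_norml; have := ll s t; have := ll t s; rewrite (distrC s t) => ? ?.
  by apply/andP; split; lra.
Unshelve. all: by end_near. Qed.

(* A moving average of the minorant [l]: the mean value theorem gives
   [th t <= l t], and [th' t = l (t + 1) - l t]. *)
Lemma slow_scale_exists p :
  (forall t, 0 < p t) -> (forall s t, s <= t -> p t <= p s) ->
  exists th dth : R -> R,
    (forall s t, 0 <= s -> s <= t -> th t <= th s) /\
    forall t, 0 <= t ->
    [/\ is_derive t 1 th (dth t), 0 < th t, th t <= p t & - p t <= dth t <= 0].
Proof.
move=> p0 pn; have [l [l0 ln lp lc]] := pos_noninc_lipschitz_minorant p0 pn.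
have [A dA] := antiderivative lc.
pose th t := A (t + 1) - A t; pose dth t := l (t + 1) - l t.
have tt1 t : t < t + 1 by rewrite ltrDl.
have dth0 t : - p t <= dth t <= 0.
  by have := lp t; have := l0 (t + 1); have := ln _ _ (ltW (tt1 t));
    rewrite /dth => ? ? ?; apply/andP; split; lra.
have dthE t : 0 <= t -> is_derive t 1 th (dth t).
  move=> t0; suff dA1 : is_derive t 1 (fun t => A (t + 1)) (l (t + 1)).
    exact: (is_derive1B dA1 (dA _ t0)).
  have dt : is_derive t 1 (fun t : R => t + 1) (1 + 0).
    exact: (@is_derive1D R t id (cst 1) 1 0).
  apply: (is_derive_eq (@is_derive1_comp _ A (fun t => t + 1) t _ _ _ dt)).
    by apply: dA; lra.
  by rewrite addr0 mulr1.
exists th, dth; split=> [s t s0 st|t t0].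
  rewrite -subr_le0; have [||c _ ->] := @MVT_segment _ th dth s t st.
  - by move=> r; rewrite in_itv/= => /andP[sr _]; apply: dthE; lra.
  - apply: derivable_within_continuous => r; rewrite in_itv/= => /andP[sr _].
    by case: (dthE r _) => //; lra.
  - by rewrite mulr_le0_ge0 ?subr_ge0//; case/andP: (dth0 c).
split=> //; first exact: dthE.
- rewrite /th; have [||c _ ->] := @MVT _ A l _ _ (tt1 t); last by have := l0 c; lra.
  + by move=> r; rewrite in_itv/= => /andP[tr _]; apply: dA; lra.
  + apply: derivable_within_continuous => r; rewrite in_itv/= => /andP[tr _].
    by case: (dA r _) => //; lra.
- rewrite /th; have [||c] := @MVT _ A l _ _ (tt1 t).
  + by move=> r; rewrite in_itv/= => /andP[tr _]; apply: dA; lra.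
  + apply: derivable_within_continuous => r; rewrite in_itv/= => /andP[tr _].
    by case: (dA r _) => //; lra.
  rewrite in_itv/= => /andP[/ltW/ln lct _] ->.
  by have := lp t; lra.
Qed.

(** Tolerances valid up to each horizon [T] are merged into one nonincreasing function, from the
    supremum of those valid up to [T]. The cap [1] makes the supremum finite; it need not be
    attained, and halving it passes below a valid tolerance. *)
Lemma tolerance_exists (Q : R -> R -> Prop) :
  (forall t v v', 0 < v' -> v' <= v -> Q t v -> Q t v') ->
  (forall T, exists2 v, 0 < v & forall t, t <= T -> Q t v) ->
  exists p : R -> R, [/\ forall t, 0 < p t, forall s t, s <= t -> p t <= p s
    & forall t, Q t (p t)].
Proof.
move=> Qd Qe.
pose S T := [set v | [/\ 0 < v, v <= 1 & forall t, t <= T -> Q t v]].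
have S0 T : S T !=set0.
  have [v v0 vQ] := Qe T; exists (Num.min v 1); split.
  - by rewrite lt_min v0 ltr01.
  - by rewrite ge_min lexx orbT.
  - move=> t tT; apply: (Qd t v) (vQ t tT); first by rewrite lt_min v0 ltr01.
    by rewrite ge_min lexx.
have ubS T : has_ubound (S T) by exists 1 => v [].
have p0 T : 0 < sup (S T).
  by have [v Sv] := S0 T; apply: (lt_le_trans _ (ub_le_sup (ubS T) Sv)); case: Sv.
exists (fun T => sup (S T) / 2); split.
- by move=> t; have := p0 t; lra.
- move=> s t st; rewrite ler_pM2r//; apply: ge_sup => // v [v0 v1 Qv].
  apply: ub_le_sup => //; split=> // r rs; apply: Qv; exact: le_trans st.
- move=> t; have : sup (S t) / 2 < sup (S t) by have := p0 t; lra.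
  move=> /(sup_gt (S0 t))[v [v0 v1 vQ] /ltW sv].
  apply: Qd sv (vQ _ _) => //; first by have := p0 t; lra.
Qed.

End slow_scale.

(** * Error of the dirty derivative *)

Section filter.
Context {R : realType}.

(* [q = (z - x)/th + g(T)] solves [q' = - (1 + th')/th q + rho/th] with
   [rho = (xh - x)/th + (g(T) - g) + th' g(T)] small; the initial value [q s]
   is forgotten because [th] is small compared with [T - s]. *)
Lemma dirty_derivative_bound (s T : R) (th dth x z xh g : R -> R)
    (P B M k : R) :
  s < T ->
  {within `[s, T], continuous x} -> {within `[s, T], continuous z} ->
  (forall t, s < t < T -> is_derive t 1 x (g t)) ->
  (forall t, s < t < T -> is_derive t 1 z ((xh t - z t) / th t)) ->
  (forall t, s <= t <= T -> [/\ is_derive t 1 th (dth t), 0 < th t,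
     th t <= th s & - P <= dth t <= 0]) ->
  th s <= P -> P <= 1 / 2 ->
  (forall t, s <= t <= T -> `|xh t - x t| <= k * th t) ->
  (forall t, s <= t <= T -> `|g T - g t| <= k) ->
  `|g T| <= M -> `|x s| <= B -> `|z s| <= B ->
  P * M <= k -> 16 * P * (2 * B + M) <= k * (T - s) ^+ 2 ->
  `|(xh T - z T) / th T - g T| <= 8 * k /\
  `|z T - x T| <= th T * (7 * k + M).
Proof.
move=> sT xc zc dx dz thP thsP P12 xhx gk gTM xB zB PMk Pk.
have sle : s <= s <= T by rewrite lexx ltW.
have Tle : s <= T <= T by rewrite lexx ltW.
have [_ ths0 _ _] := thP s sle; have [_ thT0 _ _] := thP T Tle.
have k0 : 0 <= k by apply: le_trans (gk T Tle).
have M0 : 0 <= M by apply: le_trans gTM.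
have B0 : 0 <= B by apply: le_trans xB.
pose q t := (z t - x t) * (th t)^-1 + g T.
pose a t := (1 + dth t) / th t.
pose b t := ((xh t - x t) / th t + (g T - g t) + dth t * g T) / th t.
have io t : s < t < T -> s <= t <= T by move=> /andP[/ltW -> /ltW ->].
have aP t : s <= t <= T -> (2 * th t)^-1 <= a t.
  move=> /thP[_ tht0 _ /andP[? ?]]; rewrite /a invfM ler_pM2r ?invr_gt0//; lra.
have qc : {within `[s, T], continuous q}.
  apply: within_continuousD; last first.
    by apply: continuous_subspaceT => t; exact: cvg_cst.
  have thc : {within `[s, T], continuous th}.
    apply: derivable_within_continuous => t; rewrite in_itv/= => /thP[].
    by case.
  have zxc := within_continuousB zc xc.
  have thVc : {within `[s, T], continuous (fun t => (th t)^-1)}.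
    apply/subspace_continuousP => t; rewrite /= in_itv/= => st.
    apply: cvgV; first by have [_ /lt0r_neq0] := thP t st.
    by move/subspace_continuousP : thc; apply; rewrite /= in_itv.
  apply/subspace_continuousP => t tT; apply: cvgM.
    by move/subspace_continuousP : zxc; apply.
  by move/subspace_continuousP : thVc; apply.
(* The forcing is at most [3 * k / th], and [dth >= - 1 / 2] gives [a >= 1 / (2 * th)], whence the
   level [6 * k]; as [th <= th s], the decay rate is at least [1 / (2 * th s)]. *)
have qB : `|q T| <= 6 * k + `|q s| * expR (- (2 * th s)^-1 * (T - s)).
  apply: (@linear_ode_bound R s T q a b) => //; first exact: ltW.
  - move=> t st; have [dt tht0 _ _] := thP t (io _ st).
    have dzx := is_derive1B (dz t st) (dx t st).
    have dV := is_derive1V (lt0r_neq0 tht0) dt.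
    apply: (is_derive_eq (is_derive1D (is_derive1M dzx dV) (is_derive_cst (g T) t 1))).
    by rewrite /q /a /b; field; rewrite lt0r_neq0.
  - move=> t st; have [_ tht0 _ /andP[dl du]] := thP t (io _ st).
    have h1 : `|(xh t - x t) / th t| <= k.
      by rewrite normrM normfV (gtr0_norm tht0) ler_pdivrMr// xhx// io.
    have h2 : `|dth t * g T| <= k.
      rewrite normrM (le_trans _ PMk)// ler_pM//.
      by rewrite ler_norml dl (le_trans du)//; lra.
    have h3 := gk t (io _ st).
    rewrite /b normrM normfV (gtr0_norm tht0).
    have -> : 6 * k * a t = 6 * k * (1 + dth t) / th t by rewrite /a mulrA.
    rewrite ler_pM2r ?invr_gt0//.
    have h4 : 3 * k <= 6 * k * (1 + dth t).
      have : k * (1 / 2) <= k * (1 + dth t) by rewrite ler_wpM2l//; lra.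
      lra.
    have := ler_normD ((xh t - x t) / th t + (g T - g t)) (dth t * g T).
    have := ler_normD ((xh t - x t) / th t) (g T - g t).
    lra.
  - by rewrite invr_ge0 mulr_ge0// ltW.
  - move=> t st; apply: le_trans (aP t (io _ st)).
    have [_ tht0 tts _] := thP t (io _ st).
    by rewrite lef_pV2 ?posrE ?mulr_gt0// ler_pM2l.
  - by rewrite mulr_ge0.
have Ts0 : 0 < T - s by rewrite subr_gt0.
have qs : `|q s| <= (2 * B + M) / th s.
  rewrite /q [X in _ <= X]mulrDl; apply: (le_trans (ler_normD _ _)); apply: lerD.
    rewrite normrM normfV (gtr0_norm ths0) ler_pM2r ?invr_gt0//.
    by apply: (le_trans (ler_normB _ _)); lra.
  by rewrite (le_trans gTM)// ler_peMr// invf_ge1//; lra.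
(* For [u = (T - s) / (2 * th s)], [expR (u / 2) >= 1 + u / 2] yields [expR u >= (u / 2) ^+ 2]. The
   resulting factor [th s ^+ 2] outweighs the [1 / th s] in the bound on [q s]. *)
have eB : expR (- (2 * th s)^-1 * (T - s)) <= 16 * th s ^+ 2 / (T - s) ^+ 2.
  set u := (2 * th s)^-1 * (T - s).
  have u0 : 0 < u by rewrite mulr_gt0// invr_gt0 mulr_gt0.
  have -> : 16 * th s ^+ 2 / (T - s) ^+ 2 = (u ^+ 2 / 4)^-1.
    by rewrite /u; field; rewrite !lt0r_neq0.
  rewrite mulNr expRN lef_pV2 ?posrE ?expR_gt0//; last first.
    by rewrite divr_gt0// exprn_gt0.
  have -> : expR u = expR (u / 2) ^+ 2 by rewrite expr2 -expRD; congr expR; lra.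
  have -> : u ^+ 2 / 4 = (u / 2) ^+ 2 by field.
  rewrite ler_sqr ?nnegrE ?expR_ge0//; last by lra.
  by have := expR_ge1Dx (u / 2); lra.
have qT : `|q T| <= 7 * k.
  apply: (le_trans qB); suff : `|q s| * expR (- (2 * th s)^-1 * (T - s)) <= k by lra.
  apply: (@le_trans _ _ ((2 * B + M) / th s * (16 * th s ^+ 2 / (T - s) ^+ 2))).
    by rewrite ler_pM ?expR_ge0.
  have -> : (2 * B + M) / th s * (16 * th s ^+ 2 / (T - s) ^+ 2) =
      16 * th s * (2 * B + M) / (T - s) ^+ 2.
    by field; rewrite !lt0r_neq0.
  rewrite ler_pdivrMr ?exprn_gt0// (le_trans _ Pk)//.
  by rewrite ler_wpM2r ?ler_pM2l//; lra.
split.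
  have -> : (xh T - z T) / th T - g T = (xh T - x T) / th T - q T.
    by rewrite /q; field; rewrite lt0r_neq0.
  apply: (le_trans (ler_normB _ _)).
  suff : `|(xh T - x T) / th T| <= k by lra.
  by rewrite normrM normfV (gtr0_norm thT0) ler_pdivrMr// xhx.
have -> : z T - x T = th T * (q T - g T) by rewrite /q; field; rewrite lt0r_neq0.
rewrite normrM (gtr0_norm thT0) ler_pM2l//.
by apply: (le_trans (ler_normB _ _)); lra.
Qed.

End filter.

(** * Clamped roots *)

Section row_norm.
Context {R : realType} {n : nat}.
Implicit Types x : 'rV[R]_n.

Lemma coord_le_norm x i : `|x ord0 i| <= `|x|.
Proof.
rewrite -[leRHS]/(mx_norm x) mx_normrE; apply/bigmax_geP; right.
by exists (ord0, i).
Qed.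

Lemma row_norm_le x c : 0 <= c -> (forall i, `|x ord0 i| <= c) -> `|x| <= c.
Proof.
move=> c0 xc; rewrite -[leLHS]/(mx_norm x) mx_normrE; apply/bigmax_leP; split=> //.
by move=> [i j] _ /=; rewrite ord1.
Qed.

Lemma norm_le_enorm x : `|x| <= enorm x.
Proof.
apply: row_norm_le => [|i]; first exact: sqrtr_ge0.
rewrite -sqrtr_sqr /enorm ler_sqrt; last by apply: sumr_ge0 => j _; exact: sqr_ge0.
by rewrite (bigD1 i)//= lerDl sumr_ge0// => j _; exact: sqr_ge0.
Qed.

Lemma continuous_row (T : topologicalType) (g : 'I_n -> T -> R) :
  (forall j, continuous (g j)) -> continuous (fun p => \row_j g j p).
Proof.
move=> cg p; apply/cvgrPdist_le => e e0; near=> q.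
apply: row_norm_le => [|j]; first exact: ltW.
rewrite !mxE; move: j; near: q; apply: filter_forall => j.
exact: cvgr_dist_le (cg j p) _ e0.
Unshelve. all: by end_near. Qed.

Lemma compact_norm_le c : compact [set x : 'rV[R]_n | `|x| <= c].
Proof.
apply: bounded_closed_compact.
  exists c; split; first exact: num_real.
  by move=> d cd x /= /le_trans; apply; exact: ltW.
apply: (@closed_comp _ _ (fun x => `|x|) [set y | y <= c]); last exact: closed_le.
by move=> x _; exact: norm_continuous.
Qed.

End row_norm.

(** Only [p] is confined to [K]: [q] stands for approximate data, which may leave [K]. Near each
    point of [K], half of a radius that works for [e / 2] serves all neighbouring [p]. *)
Lemma compact_uniform_continuous (R : realType) (U V : normedModType R)
    (K : set U) (phi : U -> V) e :
  compact K -> (forall p, K p -> {for p, continuous phi}) -> 0 < e ->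
  exists2 d, 0 < d & forall p q, K p -> `|p - q| <= d -> `|phi p - phi q| <= e.
Proof.
move=> /compact_near_coveringP cK cphi e0.
have : \forall d \near (0 : R)^'+,
    K `<=` (fun p => forall q, `|p - q| <= d -> `|phi p - phi q| <= e).
  apply: cK => p Kp.
  have /nbhs_ballP[r /= r0 rP] : \forall q \near p, `|phi p - phi q| <= e / 2.
    by apply: cvgr_dist_le (cphi p Kp) _ _; rewrite divr_gt0.
  have r2 : 0 < r / 2 by rewrite divr_gt0.
  near=> p' d => /= q p'q.
  have pp' : `|p - p'| < r / 2.
    have : ball p (r / 2) p' by near: p'; exact: nbhsx_ballx.
    by rewrite -ball_normE.
  have dr : d < r / 2.
    by near: d; exact: nbhs_right_lt.
  have h1 : `|phi p - phi p'| <= e / 2.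
    by apply: rP; rewrite -ball_normE /ball_ /=; lra.
  have h2 : `|phi p - phi q| <= e / 2.
    apply: rP; rewrite -ball_normE /ball_ /=.
    by apply: le_lt_trans (ler_distD p' _ _) _; lra.
  rewrite distrC in h1.
  by have := ler_distD (phi p) (phi p') (phi q); lra.
move=> dP.
near (0 : R)^'+ => d.
exists d; first by near: d; exact: nbhs_right_gt.
by move=> p q Kp; move: p Kp q; near: d.
Unshelve. all: by end_near. Qed.

Section clamped_root.
Context {R : realType}.
Implicit Types (B c x : R) (h : R -> R).

(** For an increasing [h] with a root, this is the root projected onto [[- B, B]]. The supremum
    makes sense without a root as well; for [B >= 0] the clause [a <= - B] keeps the set
    nonempty. *)
Definition clamped_root B h : R :=
  sup [set a | a <= B /\ (a <= - B \/ h a <= 0)].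

Let root_has_sup B h : 0 <= B -> has_sup [set a | a <= B /\ (a <= - B \/ h a <= 0)].
Proof.
by move=> B0; split; [exists (- B); split; [lra|left]|exists B => a []].
Qed.

Let root_ge B h a : 0 <= B -> a <= B -> a <= - B \/ h a <= 0 ->
  a <= clamped_root B h.
Proof.
by move=> B0 aB ha; apply: ub_le_sup => //; case: (root_has_sup h B0).
Qed.

Let root_le B h c : 0 <= B -> (forall a, a <= B -> a <= - B \/ h a <= 0 -> a <= c) ->
  clamped_root B h <= c.
Proof.
move=> B0 hc; apply: ge_sup; first by case: (root_has_sup h B0).
by move=> a [aB ha]; exact: hc.
Qed.

Lemma clamped_root_bound B h : 0 <= B -> `|clamped_root B h| <= B.
Proof.
move=> B0; rewrite ler_norml; apply/andP; split; last exact: root_le.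
by apply: root_ge => //; [lra|left].
Qed.

Lemma clamped_root_eq B h x : (forall a b, a < b -> h a < h b) ->
  `|x| <= B -> h x = 0 -> clamped_root B h = x.
Proof.
rewrite ler_norml => hi /andP[Bx xB] hx0; have B0 : 0 <= B by lra.
apply/eqP; rewrite eq_le; apply/andP; split; last first.
  by apply: root_ge => //; right; rewrite hx0.
apply: root_le => // a aB [|ha]; first lra.
by rewrite leNgt; apply/negP => /hi; rewrite hx0 ltNge ha.
Qed.

(** Since [h] is strictly increasing, the signs of [h p] at [r - e] and [r + e], or strict
    inequalities between these points and the bounds, persist near [p] and enclose the clamped roots
    there. *)
Lemma continuous_clamped_root (T : topologicalType) (B : T -> R) (h : T -> R -> R) :
  (forall p, 0 <= B p) -> continuous B -> (forall a, continuous (h^~ a)) ->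
  (forall p a b, a < b -> h p a < h p b) ->
  continuous (fun p => clamped_root (B p) (h p)).
Proof.
move=> B0 cB ch hi p; apply/cvgrPdist_le => e e0.
have cNB : continuous (fun p => - B p) by move=> q; apply: cvgN; exact: cB.
set r := clamped_root (B p) (h p).
have upper : \forall q \near p, clamped_root (B q) (h q) <= r + e.
  have := clamped_root_bound (h p) (B0 p); rewrite -/r ler_norml => /andP[Br rB].
  have [Bre|reB] := ltP (B p) (r + e).
    near=> q; apply: root_le => // a aB _; apply: (le_trans aB); apply: ltW.
    by near: q; exact: (cvgr_lt _ (cB p)).
  have hre : 0 < h p (r + e).
    rewrite ltNge; apply/negP => hre.
    have : r + e <= r by apply: root_ge => //; right.
    lra.
  near=> q.
  have h1 : 0 < h q (r + e) by near: q; exact: (cvgr_gt _ (ch _ p)).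
  have h2 : - B q < r + e by near: q; apply: (cvgr_lt _ (cNB p)); lra.
  apply: root_le => // a aB [|ha]; first lra.
  by rewrite leNgt; apply/negP => /hi-/(_ q); lra.
have lower : \forall q \near p, r - e <= clamped_root (B q) (h q).
  have rer : r - e < r by lra.
  have [a [aB ha] rea] := sup_gt (root_has_sup (h p) (B0 p)).1 rer.
  case: ha => ha.
    near=> q; have hq : r - e < - B q by near: q; apply: (cvgr_gt _ (cNB p)); lra.
    by apply: root_ge => //; [have := B0 q; lra|left; exact: ltW].
  have hre : h p (r - e) < 0 by have := hi p _ _ rea; lra.
  have reB : r - e < B p by lra.
  near=> q; apply: root_ge => //; last right; apply: ltW; near: q.
    exact: (cvgr_gt _ (cB p)).
  exact: (cvgr_lt _ (ch _ p)).
near=> q; rewrite ler_norml.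
have h1 : clamped_root (B q) (h q) <= r + e by near: q.
have h2 : r - e <= clamped_root (B q) (h q) by near: q.
by apply/andP; split; lra.
Unshelve. all: by end_near. Qed.

End clamped_root.

Lemma is_derive_rowP (R : realType) n (t : R) (x : R -> 'rV[R]_n) dx :
  is_derive t 1 x dx <->
  forall i, is_derive t 1 (fun s => x s ord0 i) (dx ord0 i).
Proof.
split=> [[dxt <-] i|dxt].
  apply: DeriveDef; first by have /derivable_mxP := dxt; apply.
  by rewrite derive_mx// mxE.
have h : derivable x t 1.
  by apply/derivable_mxP => i j; rewrite ord1; case: (dxt j).
apply: DeriveDef => //; rewrite derive_mx//; apply/rowP => i.
by rewrite mxE; case: (dxt i).
Qed.

Lemma within_continuous_rowP (R : realType) n (D : set R) (x : R -> 'rV[R]_n) :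
  {within D, continuous x} <->
  forall i, {within D, continuous (fun t => x t ord0 i)}.
Proof.
split=> [xc i t|xc].
  by apply: (@continuous_comp _ _ _ _ (fun v : 'rV[R]_n => v ord0 i));
    [exact: xc|exact: coord_continuous].
have -> : x = (fun t => \row_j x t ord0 j).
  by apply/funext => t; apply/rowP => j; rewrite mxE.
exact: (@continuous_row _ _ (subspace D)).
Qed.

Lemma solution_onS (R : realType) n (D D' : set R)
    (F : R -> 'rV[R]_n -> 'rV[R]_n) x :
  D' `<=` D -> solution_on D F x -> solution_on D' F x.
Proof.
move=> DD [xc dx]; split; first exact: continuous_subspaceW DD xc.
by move=> t /(interiorS DD); exact: dx.
Qed.

Lemma continuous_pair (S T U : topologicalType) (f : S -> T) (g : S -> U) :
  continuous f -> continuous g -> continuous (fun x => (f x, g x)).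
Proof. by move=> cf cg x; apply: (cvg_pair (cf x) (cg x)). Qed.

Lemma continuous_after (S T U : topologicalType) (g : T -> U) (f : S -> T) :
  continuous g -> continuous f -> continuous (fun x => g (f x)).
Proof. by move=> cg cf x; apply: continuous_comp; [exact: cf|exact: cg]. Qed.

Lemma continuous_fst (S T : topologicalType) : continuous (fst : S * T -> S).
Proof. by move=> x; exact: cvg_fst. Qed.

Lemma continuous_snd (S T : topologicalType) : continuous (snd : S * T -> T).
Proof. by move=> x; exact: cvg_snd. Qed.

(** * Continuous inversion in one coordinate *)

Section partial_inverse.
Context {R : realType} {X : normedModType R}.
Variables (Fk : R -> X -> R) (B : R -> R) (e : X).
Hypothesis Fk_cont : continuous (fun p : R * X => Fk p.1 p.2).
Hypothesis B_cont : continuous B.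
Hypothesis B_ge0 : forall t, 0 <= B t.
Hypothesis Fk_mono : forall t v, strictly_monotone (fun a => Fk t (v + a *: e)).

(* The last factor gives the equation the sign that makes it increasing in [a]. *)
Definition partial_inverse t v w :=
  clamped_root (B t) (fun a => (Fk t (v + a *: e) - w) * (Fk t (v + e) - Fk t v)).

Lemma partial_inverse_bound t v w : `|partial_inverse t v w| <= B t.
Proof. exact: clamped_root_bound. Qed.

Let signed_increasing t v w a b : a < b ->
  (Fk t (v + a *: e) - w) * (Fk t (v + e) - Fk t v) <
  (Fk t (v + b *: e) - w) * (Fk t (v + e) - Fk t v).
Proof.
move=> ab; have := Fk_mono t v; rewrite /strictly_monotone => -[] mon.
  have := mon 0 1 ltr01; rewrite scale0r addr0 scale1r => S0.
  by rewrite ltr_pM2r ?subr_gt0// ltrD2r mon.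
have := mon 0 1 ltr01; rewrite scale0r addr0 scale1r => S0.
by rewrite ltr_nM2r ?subr_lt0// ltrD2r mon.
Qed.

Lemma partial_inverse_eq t v a : `|a| <= B t ->
  partial_inverse t v (Fk t (v + a *: e)) = a.
Proof.
by move=> aB; apply: clamped_root_eq => //; rewrite ?subrr ?mul0r//;
  exact: signed_increasing.
Qed.

Lemma continuous_partial_inverse :
  continuous (fun p : R * X * R => partial_inverse p.1.1 p.1.2 p.2).
Proof.
have cF (c : R * X * R -> X) : continuous c ->
    continuous (fun p : R * X * R => Fk p.1.1 (c p)).
  move=> cc.
  apply: (continuous_after Fk_cont (continuous_pair _ cc)).
  exact: continuous_after (@continuous_fst _ _) (@continuous_fst _ _).
have c12 : continuous (fun p : R * X * R => p.1.2).
  exact: continuous_after (@continuous_snd _ _) (@continuous_fst _ _).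
apply: (@continuous_clamped_root R _ (fun p : R * X * R => B p.1.1)
  (fun p a => (Fk p.1.1 (p.1.2 + a *: e) - p.2) *
              (Fk p.1.1 (p.1.2 + e) - Fk p.1.1 p.1.2))) => //.
- apply: (continuous_after B_cont).
  exact: continuous_after (@continuous_fst _ _) (@continuous_fst _ _).
- move=> a p; apply: cvgM; apply: cvgB.
  + apply: (cF (fun p => p.1.2 + a *: e)) => q; apply: cvgD; first exact: c12.
    exact: cvg_cst.
  + exact: cvg_snd.
  + apply: (cF (fun p => p.1.2 + e)) => q; apply: cvgD; first exact: c12.
    exact: cvg_cst.
  + exact: (cF (fun p => p.1.2)).
- by move=> p a b; exact: signed_increasing.
Qed.

(** On exact data [(t, P x, Fk t x)] the inverse returns [c x]. Up to time [T] these data lie in a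
    compact set [K], near which the inverse is uniformly continuous. *)
Lemma partial_inverse_tolerance (P : X -> X) (c : X -> R) T eps :
  (forall r, compact [set x : X | `|x| <= r]) ->
  continuous P -> (forall x, `|c x| <= `|x|) ->
  (forall t x, Fk t (P x + c x *: e) = Fk t x) ->
  (forall s t, s <= t -> B s <= B t) -> 0 < eps ->
  exists2 d, 0 < d & forall t x v w, 0 <= t <= T -> `|x| <= B t ->
    `|v - P x| <= d -> `|w - Fk t x| <= d ->
    `|partial_inverse t v w - c x| <= eps.
Proof.
move=> cX cP cle FP Bn eps0.
pose h (p : R * X) := (p.1, P p.2, Fk p.1 p.2).
pose K := h @` (`[0, T]%classic `*` [set x | `|x| <= B T]).
have cK : compact K.
  apply: continuous_compact; last first.
    by apply: compact_setX => //; exact: segment_compact.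
  apply: continuous_subspaceT; apply: continuous_pair Fk_cont.
  apply: (continuous_pair (@continuous_fst _ _)).
  exact: (continuous_after cP (@continuous_snd _ _)).
have [d d0 dP] := compact_uniform_continuous cK
  (fun p _ => @continuous_partial_inverse p) eps0.
exists d => // t x v w tT xB vP wF.
have Kp : K (t, P x, Fk t x).
  exists (t, x) => //; split=> /=; first by rewrite in_itv.
  by apply: (le_trans xB); apply: Bn; case/andP: tT.
have := dP (t, P x, Fk t x) (t, v, w) Kp.
rewrite /= -{2}(FP t x) partial_inverse_eq; last exact: le_trans xB.
move=> close; rewrite distrC; apply: close.
rewrite !prod_normE/= !ge_max subrr normr0 (ltW d0) distrC vP/=.
by rewrite distrC.
Qed.

End partial_inverse.

(** * Velocities of trajectories in the box *)

Section curves.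
Context {R : realType} {n : nat}.
Variables (F : R -> 'rV[R]_n -> 'rV[R]_n) (B : R -> R).
Hypothesis F_cont : continuous (fun p : R * 'rV[R]_n => F p.1 p.2).
Hypothesis B_nondec : forall s t, s <= t -> B s <= B t.

(** [M] bounds [F] on the compact box, so a trajectory moves by at most [M * d] in time [d], and
    uniform continuity of [F] bounds the variation of its velocity. The constants are common to all
    trajectories in the box and all end times up to [T]. *)
Lemma curve_velocity_modulus T eps : 0 < eps ->
  exists d M, [/\ 0 < d <= 1, 0 <= M & forall s T' x, 0 <= s -> T' <= T ->
    T' - d <= s -> s <= T' ->
    solution_on `[s, T']%classic F x ->
    (forall t, s <= t <= T' -> `|x t| <= B t) ->
    forall t, s <= t <= T' ->
    `|F t (x t)| <= M /\ `|F T' (x T') - F t (x t)| <= eps].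
Proof.
move=> eps0.
pose K : set (R * 'rV[R]_n) := `[0, T]%classic `*` [set x | `|x| <= B T].
have cK : compact K.
  by apply: compact_setX; [exact: segment_compact|exact: compact_norm_le].
have [M M0 FM] : exists2 M, 0 <= M & forall p, K p -> `|F p.1 p.2| <= M.
  have : bounded_set ((fun p : R * 'rV[R]_n => F p.1 p.2) @` K).
    apply: compact_bounded; apply: continuous_compact => //.
    exact: continuous_subspaceT.
  move=> [M [Mr MP]]; exists (`|M| + 1) => [|p Kp]; first by rewrite addr_ge0.
  apply: (MP (`|M| + 1)); last by exists p.
  by rewrite (le_lt_trans (ler_norm _))// ltrDl.
have [d' d'0 dP] := compact_uniform_continuous cK (fun p _ => @F_cont p) eps0.
have M1 : 0 < M + 1 by lra.
(* [M + 1] is positive even if [M = 0]; being at least [1], it also yields [d <= d'], which handles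
   the time component. *)
exists (Num.min 1 (d' / (M + 1))), M; split=> //.
  by rewrite lt_min ltr01 divr_gt0//= ge_min lexx.
move=> s T' x s0 T'T; set d := Num.min _ _ => ds sT' xs xB.
have Kx t : s <= t <= T' -> K (t, x t).
  move=> /andP[st tT']; split=> /=.
    by rewrite in_itv/= (le_trans s0 st) (le_trans tT').
  by rewrite (le_trans (xB _ _)) ?st// B_nondec// (le_trans tT').
have FMx t : s <= t <= T' -> `|F t (x t)| <= M by move=> /Kx/FM.
move=> t stT; split; first exact: FMx.
have [st tT'] := andP stT.
have dd' : d * (M + 1) <= d' by rewrite -ler_pdivlMr// ge_min lexx orbT.
have d1 : d <= 1 by rewrite ge_min lexx.
have d0 : 0 < d by rewrite lt_min ltr01 divr_gt0.
have Td : T' - t <= d by lra.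
have h1 : d <= d' by apply: le_trans dd'; rewrite ler_peMr//; lra.
apply: (dP (T', x T') (t, x t)); first by apply: Kx; rewrite lexx andbT.
rewrite prod_normE/= ge_max; apply/andP; split.
  by rewrite ger0_norm ?subr_ge0//; lra.
apply: row_norm_le => [|i]; first exact: ltW.
have [xc dx] := xs; rewrite !mxE.
have [||c + ->] := @MVT_segment _ (fun t => x t ord0 i)
    (fun t => F t (x t) ord0 i) t T' tT'.
- move=> r; rewrite in_itv/= => /andP[tr rT].
  have /dx/is_derive_rowP : `[s, T']%classic° r.
    by rewrite interior_itv_bnd /= in_itv/= (le_lt_trans st tr).
  exact.
- have /within_continuous_rowP/(_ i) := xc.
  apply: continuous_subspaceW => r /=; rewrite !in_itv/= => /andP[tr ->].
  by rewrite (le_trans st tr).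
rewrite in_itv/= => /andP[tc cT].
have Fc : `|F c (x c) ord0 i| <= M.
  by apply: le_trans (coord_le_norm _ _) _; apply: FMx; rewrite (le_trans st tc).
rewrite normrM (ger0_norm (x := T' - t)) ?subr_ge0//.
apply: le_trans dd'; rewrite mulrC ler_pM ?subr_ge0//; lra.
Qed.

End curves.

(** * One stage of the cascade *)

(** Natural-number indices spare the inductions over stages a bounded index type; [inord] sends
    indices beyond [m] to the first coordinate. *)
Definition coord (R : realType) m k (x : 'rV[R]_m.+1) : R := x ord0 (inord k).

(** Padding with zeros, instead of changing the dimension, keeps the estimates of all stages in one
    space. *)
Definition head (R : realType) m k (x : 'rV[R]_m.+1) : 'rV[R]_m.+1 :=
  \row_j (if (j < k)%N then x ord0 j else 0).

Definition unit_row (R : realType) m k : 'rV[R]_m.+1 := \row_j (j == k :> nat)%:R.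

Section coordinates.
Context {R : realType} {m : nat}.
Implicit Types (x y : 'rV[R]_m.+1) (k j : nat).

Lemma coord_le_norm_rV k x : `|coord k x| <= `|x|.
Proof. exact: coord_le_norm. Qed.

Lemma coordD k x y : coord k (x + y) = coord k x + coord k y.
Proof. by rewrite /coord mxE. Qed.

Lemma coordN k x : coord k (- x) = - coord k x.
Proof. by rewrite /coord mxE. Qed.

Lemma coordZ k a x : coord k (a *: x) = a * coord k x.
Proof. by rewrite /coord mxE. Qed.

Lemma coord_unit_row k j : (j <= m)%N -> coord j (unit_row R m k) = (j == k)%:R.
Proof. by move=> jm; rewrite /coord mxE inordK. Qed.

Lemma coord_head k j x : (j < k)%N -> (j <= m)%N -> coord j (head k x) = coord j x.
Proof. by move=> jk jm; rewrite /coord mxE inordK// jk. Qed.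

Lemma head_succ k x : (k <= m)%N ->
  head k.+1 x = head k x + coord k x *: unit_row R m k.
Proof.
move=> km; apply/rowP => j; rewrite !mxE ltnS leq_eqVlt.
have [jk|jk] := eqVneq (j : nat) k.
  rewrite -jk ltnn /= add0r mulr1 /coord; congr (x _ _).
  by apply: val_inj; rewrite /= inordK.
by rewrite mulr0 addr0.
Qed.

Lemma head_0 x : head 0 x = 0.
Proof. by apply/rowP => j; rewrite !mxE. Qed.

Lemma norm_unit_row k : `|unit_row R m k| <= 1.
Proof.
apply: row_norm_le => // i; rewrite mxE; case: (_ == _); rewrite ?normr0 ?normr1 ?ler01//.
Qed.

Lemma continuous_coord k : continuous (@coord R m k).
Proof. exact: coord_continuous. Qed.

Lemma continuous_head k : continuous (@head R m k).
Proof.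
apply: continuous_row => j /=; case: ltnP => _; first exact: coord_continuous.
exact: cst_continuous.
Qed.

End coordinates.

Definition pos_noninc (R : realType) (p : R -> R) :=
  (forall t, 0 < p t) /\ (forall s t, s <= t -> p t <= p s).

Section stages.
Context {R : realType} {m : nat}.
Variables (F : R -> 'rV[R]_m.+1 -> 'rV[R]_m.+1) (B : R -> R).
Hypothesis F_cont : continuous (fun p : R * 'rV[R]_m.+1 => F p.1 p.2).
Hypothesis B_ge0 : forall t, 0 <= B t.
Hypothesis B_nondec : forall s t, s <= t -> B s <= B t.

Definition next_coord k :=
  partial_inverse (fun t x => coord k (F t x)) B (unit_row R m k.+1).

(** Apply [dirty_derivative_bound] with [k = kap T / 8]. Its smallness conditions hold for
    tolerances uniform up to any horizon, hence for a nonincreasing [p], and [slow_scale_exists]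
    turns [p] into a time constant. *)
Lemma filter_stage k (kap : R -> R) : pos_noninc kap ->
  exists th dth eta : R -> R,
  [/\ pos_noninc eta, forall t, eta t <= kap t,
    forall t : R, 0 <= t -> is_derive t 1 th (dth t) /\ 0 < th t &
    forall (T : R) x (z xh : R -> R), 1 <= T ->
      solution_on `[T - 1, T]%classic F x ->
      (forall t, T - 1 <= t <= T -> `|x t| <= B t) ->
      {within `[T - 1, T], continuous z} ->
      (forall t : R, T - 1 < t < T -> is_derive t 1 z ((xh t - z t) / th t)) ->
      (forall t, T - 1 <= t <= T -> `|z t| <= B t) ->
      (forall t, T - 1 <= t <= T -> `|xh t - coord k (x t)| <= eta t) ->
      `|(xh T - z T) / th T - coord k (F T (x T))| <= kap T /\
      `|z T - coord k (x T)| <= kap T].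
Proof.
move=> [kap0 kapn].
pose Mod T d M := [/\ 0 < d <= 1, 0 <= M & forall s x, 0 <= s ->
    T - d <= s -> s <= T -> solution_on `[s, T]%classic F x ->
    (forall t, s <= t <= T -> `|x t| <= B t) ->
    forall t, s <= t <= T ->
    `|F t (x t)| <= M /\ `|F T (x T) - F t (x t)| <= kap T / 8].
pose Q T v := exists d M, [/\ Mod T d M, v <= 1 / 2, v * M <= kap T / 8 &
    16 * v * (2 * B T + M) <= kap T / 8 * d ^+ 2].
have [|T|p [p0 pn pQ]] := @tolerance_exists R Q.
- move=> T v v' v'0 v'v [d [M [Md v2 vM vB]]]; exists d, M; split=> //.
  + exact: le_trans v2.
  + apply: le_trans vM; rewrite ler_wpM2r//; by case: Md.
  + apply: le_trans vB; rewrite ler_wpM2r//; last by rewrite ler_pM2l.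
    by case: Md => _ M0 _; have := B_ge0 T; lra.
- have k8 : 0 < kap T / 8 by have := kap0 T; lra.
  have [d [M [d01 M0 dM]]] := curve_velocity_modulus F_cont B_nondec T k8.
  have [d0 d1] := andP d01.
  (* The largest [v] with [16 * v * (2 * B T + M + 1) <= kap T / 8 * d ^+ 2]; the [1] makes the
     denominator positive. Since [d <= 1], the bound on [v * M] follows too. *)
  pose c := kap T / 8 * d ^+ 2 / (16 * (2 * B T + M + 1)).
  have D0 : 0 < 16 * (2 * B T + M + 1) by have := B_ge0 T; lra.
  have c0 : 0 < c by rewrite divr_gt0// mulr_gt0// exprn_gt0.
  have cE : c * (16 * (2 * B T + M + 1)) = kap T / 8 * d ^+ 2.
    by rewrite /c divfK// gt_eqF.
  have d21 : d ^+ 2 <= 1 by rewrite exprn_ile1// ltW.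
  exists (Num.min (1 / 2) c); first by rewrite lt_min c0 andbT; lra.
  (* Constants found for [T] serve all earlier [t], because [kap] is nonincreasing and [B]
     nondecreasing. *)
  move=> t tT; have kTt := kapn _ _ tT; have BtT := B_nondec tT.
  exists d, M; set v := Num.min _ _.
  have vc : v <= c by rewrite ge_min lexx orbT.
  have v0 : 0 <= v by rewrite le_min (ltW c0) andbT; lra.
  have kd : kap T / 8 * d ^+ 2 <= kap T / 8 by rewrite ler_piMr// ltW.
  split.
  + split=> // s x s0 ds st xs xB r /(dM s t x s0 tT ds st xs xB)[-> /le_trans FTr].
    by split=> //; apply: FTr; lra.
  + by rewrite ge_min lexx.
  + have : v * M <= c * (16 * (2 * B T + M + 1)).
      by apply: ler_pM => //; have := B_ge0 T; lra.
    lra.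
  + have : v * (2 * B t + M) <= c * (2 * B T + M + 1).
      by apply: ler_pM => //; have := B_ge0 t; lra.
    have : kap T / 8 * d ^+ 2 <= kap t / 8 * d ^+ 2.
      by rewrite ler_wpM2r ?exprn_ge0 ?(ltW d0)//; lra.
    lra.
(* The shift by one covers the window: for [t >= T - 1], [p (t + 1) <= p T]. *)
have [||th [dth [thn thP]]] := @slow_scale_exists R (fun t => p (t + 1)).
- by move=> t; exact: p0.
- by move=> s t st; apply: pn; lra.
have max0 (t : R) : 0 <= Num.max 0 t by rewrite le_max lexx.
(* The filter divides the input error by [th], so the input precision carries a factor [th].
   [Num.max 0 t] keeps it positive at negative times. *)
exists th, dth, (fun t => th (Num.max 0 t) * (kap (Num.max 0 t + 1) / 8)).
have th12 t : 0 <= t -> th t <= 1 / 2.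
  by move=> /thP[_ _ thp _]; have [d [M [_ /(le_trans thp)]]] := pQ (t + 1).
split.
- split=> [t|s t st].
    have [_ th0 _ _] := thP _ (max0 t); rewrite mulr_gt0//.
    by have := kap0 (Num.max 0 t + 1); lra.
  have mst : Num.max 0 s <= Num.max 0 t by rewrite ge_max !le_max lexx/= st orbT.
  have [_ th0 _ _] := thP _ (max0 t); apply: ler_pM => //.
  + exact: ltW.
  + by have := kap0 (Num.max 0 t + 1); lra.
  + exact: thn.
  + by have := @kapn (Num.max 0 s + 1) (Num.max 0 t + 1); lra.
- move=> t; have := th12 _ (max0 t); have [_ th0 _ _] := thP _ (max0 t) => th2.
  have kt : kap (Num.max 0 t + 1) <= kap t.
    by apply: kapn; have : t <= Num.max 0 t; [rewrite le_max lexx orbT|lra].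
  have k0 := kap0 (Num.max 0 t + 1).
  have : th (Num.max 0 t) * (kap (Num.max 0 t + 1) / 8) <=
      1 / 2 * (kap (Num.max 0 t + 1) / 8).
    by apply: ler_pM => //; lra.
  lra.
- by move=> t /thP[].
move=> T x z xh T1 xs xB zc dz zB xhx.
have [d [M [[/andP[d0 d1] M0 dM] v2 vM vB]]] := pQ T.
(* Only the last [d] units of the window are used, where the velocity is nearly constant. *)
pose s := T - d.
have Ts : T - 1 <= s by rewrite /s; lra.
have sT : s < T by rewrite /s; lra.
have s0 : 0 <= s by lra.
have sTW t : s <= t <= T -> T - 1 <= t <= T.
  by move=> /andP[st ->]; rewrite (le_trans Ts st).
have sub : `[s, T] `<=` `[T - 1, T].
  by move=> t /=; rewrite !in_itv/=; exact: sTW.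
have sub' t : s < t < T -> T - 1 < t < T.
  by move=> /andP[st ->]; rewrite (le_lt_trans Ts st).
have dxx t : s < t < T -> is_derive t 1 (fun t => coord k (x t)) (coord k (F t (x t))).
  move=> st; have [_ dx] := xs.
  have /dx/is_derive_rowP : `[T - 1, T]%classic° t.
    by rewrite interior_itv_bnd /= in_itv/= sub'.
  exact.
have xcc : {within `[s, T], continuous (fun t => coord k (x t))}.
  have [/within_continuous_rowP xc _] := xs.
  exact: continuous_subspaceW sub (xc _).
have xs' := solution_onS sub xs.
have FM t : s <= t <= T -> `|F t (x t)| <= M /\ `|F T (x T) - F t (x t)| <= kap T / 8.
  by apply: (dM s x s0 (lexx _) (ltW sT) xs') => // r /sTW; exact: xB.
have sle : s <= s <= T by rewrite lexx ltW.
have Tle : s <= T <= T by rewrite lexx ltW.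
have t0 t : s <= t <= T -> 0 <= t by move=> /andP[st _]; exact: le_trans st.
have pT t : s <= t <= T -> p (t + 1) <= p T.
  by move=> /sTW/andP[? _]; apply: pn; lra.
have [||||||||||||w zx] := @dirty_derivative_bound R s T th dth (fun t => coord k (x t))
   z xh (fun t => coord k (F t (x t))) (p T) (B T) M (kap T / 8) sT xcc _ dxx.
- exact: continuous_subspaceW sub zc.
- by move=> t /sub'; exact: dz.
- move=> t st; have [dt tht _ /andP[dl du]] := thP t (t0 t st).
  split=> //; first by apply: thn => //; case/andP: st.
  by rewrite du andbT; have := pT t st; lra.
- have [_ _ /le_trans thp _] := thP s s0; exact: thp (pT s sle).
- exact: v2.
- move=> t st; apply: le_trans (xhx t (sTW t st)) _.
  rewrite max_r ?t0// mulrC ler_wpM2r//; last first.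
    suff : kap (t + 1) <= kap T by lra.
    by apply: kapn; have /andP[] := sTW t st; lra.
  by have [_ /ltW] := thP t (t0 t st).
- move=> t st; have [_ h] := FM t st; apply: le_trans h.
  by rewrite -coordN -coordD; exact: coord_le_norm_rV.
- by have [h _] := FM T Tle; apply: le_trans h; exact: coord_le_norm_rV.
- apply: (le_trans (coord_le_norm_rV _ _)); apply: le_trans (B_nondec (ltW sT)).
  by apply: xB; exact: sTW.
- by apply: le_trans (B_nondec (ltW sT)); apply: zB; exact: sTW.
- exact: vM.
- by have -> : T - s = d by rewrite /s; ring.
split; first by lra.
have [_ thT0 thp _] := thP T (t0 T Tle); have := kap0 T => kT.
have thpT : th T <= p T by apply: le_trans (pT T Tle).
have h1 : th T * M <= p T * M by rewrite ler_wpM2r.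
have h2 : th T * (7 * (kap T / 8)) <= 1 / 2 * (7 * (kap T / 8)).
  by rewrite ler_wpM2r//; lra.
lra.
Qed.

End stages.

(** * Composition of the stages *)

Section cascade.
Context {R : realType} {m : nat}.
Variables (F : R -> 'rV[R]_m.+1 -> 'rV[R]_m.+1) (B : R -> R).
Hypothesis F_cont : continuous (fun p : R * 'rV[R]_m.+1 => F p.1 p.2).
Hypothesis B_cont : continuous B.
Hypothesis B_ge0 : forall t, 0 <= B t.
Hypothesis B_nondec : forall s t, s <= t -> B s <= B t.
Hypothesis F_head : forall k t x, (k < m)%N ->
  coord k (F t (head k.+2 x)) = coord k (F t x).
Hypothesis F_mono : forall k t v, (k < m)%N ->
  strictly_monotone (fun a => coord k (F t (v + a *: unit_row R m k.+1))).

(* The curve [V] estimates the coordinates [0, ..., k] of [x] with error [eta];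
   [z] is the filter of coordinate [k], and [eta'] bounds the error of [z] and
   of the estimate of one more coordinate. *)
Definition stage k (th eta eta' : R -> R) :=
  [/\ pos_noninc eta, forall t, eta t <= eta' t,
    forall t : R, 0 <= t -> {for t, continuous th} /\ 0 < th t &
    forall (T : R) x (z : R -> R) (V : R -> 'rV[R]_m.+1), 1 <= T ->
      solution_on `[T - 1, T]%classic F x ->
      (forall t, T - 1 <= t <= T -> `|x t| <= B t) ->
      {within `[T - 1, T], continuous z} ->
      (forall t : R, T - 1 < t < T ->
         is_derive t 1 z ((coord k (V t) - z t) / th t)) ->
      (forall t, T - 1 <= t <= T -> `|z t| <= B t) ->
      (forall t, T - 1 <= t <= T -> `|V t - head k.+1 (x t)| <= eta t) ->
      `|z T - coord k (x T)| <= eta' T /\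
      ((k < m)%N -> `|V T + next_coord F B k T (V T) ((coord k (V T) - z T) / th T)
         *: unit_row R m k.+1 - head k.+2 (x T)| <= eta' T)].

(** Half of the precision [eta'] goes to the coordinates already estimated, half to the one
    recovered by the partial inverse. The latter fixes the precision [kap] demanded of the filter,
    and [filter_stage] then provides [th] and [eta]. *)
Lemma stage_exists k eta' : (k <= m)%N -> pos_noninc eta' ->
  exists th eta : R -> R, stage k th eta eta'.
Proof.
move=> km [eta0 etan].
pose Q t v := v <= eta' t / 2 /\ ((k < m)%N -> 0 <= t -> forall x v' w,
  `|x| <= B t -> `|v' - head k.+1 x| <= v -> `|w - coord k (F t x)| <= v ->
  `|next_coord F B k t v' w - coord k.+1 x| <= eta' t / 2).
have [|T|kap [kap0 kapn kapQ]] := @tolerance_exists R Q.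
- move=> t v v' v'0 v'v [v2 vP]; split; first exact: le_trans v2.
  by move=> klm t0 x u w xB /le_trans/(_ v'v) ux /le_trans/(_ v'v) wF; exact: vP.
- have e2 : 0 < eta' T / 2 by have := eta0 T; lra.
  have [km'|mk] := ltnP k m; last first.
    exists (eta' T / 2) => // t tT; split; last by rewrite ltnNge mk.
    by have := etan _ _ tT; lra.
  have cFk : continuous (fun p : R * 'rV[R]_m.+1 => coord k (F p.1 p.2)).
    exact: (continuous_after (@continuous_coord R m k) F_cont).
  have FP t x : coord k (F t (head k.+1 x + coord k.+1 x *: unit_row R m k.+1)) =
      coord k (F t x) by rewrite -head_succ// F_head.
  have [d d0 dP] := @partial_inverse_tolerance R _ (fun t x => coord k (F t x)) B
    (unit_row R m k.+1) cFk B_cont B_ge0 (fun t v => F_mono t v km')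
    (head k.+1) (coord k.+1) T (eta' T / 2) (@compact_norm_le R m.+1)
    (@continuous_head R m k.+1) (coord_le_norm_rV _) FP B_nondec e2.
  exists (Num.min d (eta' T / 2)); first by rewrite lt_min d0.
  move=> t tT; have := etan _ _ tT => eTt; split=> [|_ t0 x v w xB].
    by rewrite ge_min; apply/orP; right; lra.
  rewrite !le_min => /andP[vx _] /andP[wF _].
  by apply: (@le_trans _ _ (eta' T / 2)); [apply: dP => //; rewrite t0|lra].
have [th [dth [eta [etaP etak thP stP]]]] :=
  filter_stage F_cont B_ge0 B_nondec k (conj kap0 kapn).
have kape t : kap t <= eta' t / 2 by have [] := kapQ t.
exists th, eta; split=> //.
- by move=> t; apply: le_trans (etak t) _; have := kape t; have := eta0 t; lra.
- by move=> t /thP[/is_derive1_continuous].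
move=> T x z V T1 xs xB zc dz zB Vx.
have T0 : 0 <= T by lra.
have TW : T - 1 <= T <= T by rewrite lexx andbT; lra.
have [|w zx] := stP T x z (fun t => coord k (V t)) T1 xs xB zc dz zB.
- move=> t tT; apply: le_trans (Vx t tT).
  rewrite -(@coord_head _ _ k.+1 k (x t))// -coordN -coordD; exact: coord_le_norm_rV.
split; first by have := kape T; have := eta0 T; lra.
move=> km'; have [_ /(_ km' T0 (x T) (V T) _ (xB T TW))] := kapQ T.
move=> /(_ _ (le_trans (Vx T TW) (etak T)) w).
set a := next_coord _ _ _ _ _ _ => aP.
rewrite head_succ//.
have -> : V T + a *: unit_row R m k.+1 -
    (head k.+1 (x T) + coord k.+1 (x T) *: unit_row R m k.+1) =
    (V T - head k.+1 (x T)) + (a - coord k.+1 (x T)) *: unit_row R m k.+1.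
  by rewrite scalerBl opprD addrACA.
apply: le_trans (ler_normD _ _) _.
have h1 := Vx T TW; have h2 := etak T; have h3 := kape T.
suff : `|(a - coord k.+1 (x T)) *: unit_row R m k.+1| <= eta' T / 2 by lra.
rewrite normrZ; apply: le_trans aP; rewrite ler_piMr//; exact: norm_unit_row.
Qed.

(** Backward induction: [delta] is prescribed after the last stage, and each stage determines the
    precision required of the one before. *)
Lemma stages_exist delta : pos_noninc delta ->
  exists th eta : nat -> R -> R, eta m.+1 = delta /\
    forall k, (k <= m)%N -> stage k (th k) (eta k) (eta k.+1).
Proof.
move=> deltaP.
suff : forall j, (j <= m.+1)%N -> exists th eta : nat -> R -> R,
    [/\ eta m.+1 = delta, pos_noninc (eta (m.+1 - j)%N) &
     forall k, (m.+1 - j <= k <= m)%N -> stage k (th k) (eta k) (eta k.+1)].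
  move=> /(_ m.+1 (leqnn _))[th [eta [em _ st]]]; exists th, eta; split=> // k km.
  by apply: st; rewrite subnn.
elim=> [_|j IH jm].
  exists (fun _ => delta), (fun _ => delta); rewrite subn0; split=> // k.
  by rewrite leqNgt ltnS andNb.
have [th [eta [em etaP st]]] := IH (ltnW jm).
have ejS : (m.+1 - j)%N = (m.+1 - j.+1).+1 by rewrite subnSK.
have k0m : (m.+1 - j.+1 <= m)%N by rewrite subSS leq_subr.
rewrite ejS in etaP st.
have [th0 [eta0 st0]] := stage_exists k0m etaP.
set k0 := (m.+1 - j.+1)%N in k0m etaP st st0 *.
(* [j] counts the stages settled so far from the end; the families are overwritten at the single
   index [k0] just below them. *)
exists (fun k => if k == k0 then th0 else th k).
exists (fun k => if k == k0 then eta0 else eta k); split.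
- by rewrite gtn_eqF// ltnS.
- by rewrite eqxx; case: st0.
- move=> k /andP[]; rewrite leq_eqVlt => /predU1P[<- _|k0k km].
    by rewrite eqxx gtn_eqF.
  by rewrite !gtn_eqF//; [apply: st; rewrite k0k|exact: leqW].
Qed.

End cascade.

(** * The observer *)

Section observer.
Context {R : realType} {m : nat}.
Variables (F : R -> 'rV[R]_m.+1 -> 'rV[R]_m.+1) (B : R -> R) (th : nat -> R -> R).
Hypothesis F_cont : continuous (fun p : R * 'rV[R]_m.+1 => F p.1 p.2).
Hypothesis B_cont : continuous B.
Hypothesis B_ge0 : forall t, 0 <= B t.
Hypothesis F_mono : forall k t v, (k < m)%N ->
  strictly_monotone (fun a => coord k (F t (v + a *: unit_row R m k.+1))).
Hypothesis th_pos_cont : forall k (t : R), (k <= m)%N -> 0 <= t ->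
  {for t, continuous (th k)} /\ 0 < th k t.

(** Step [k] reconstructs the coordinates [0, ..., k] from the output and the filters of index below
    [k]. This strict dependence makes the observer a cascade. *)
Fixpoint estimate t (z : 'rV[R]_m.+1) (y : R) k : 'rV[R]_m.+1 :=
  if k is k'.+1 then
    let V := estimate t z y k' in
    V + next_coord F B k' t V ((coord k' V - coord k' z) / th k' (Num.max 0 t))
        *: unit_row R m k'.+1
  else y *: unit_row R m 0.

Definition observer t (z : 'rV[R]_m.+1) (y : R) : 'rV[R]_m.+1 :=
  \row_(j < m.+1) ((coord j (estimate t z y j) - coord j z) / th j (Num.max 0 t)).

Lemma coord_ord (x : 'rV[R]_m.+1) (i : 'I_m.+1) : coord i x = x ord0 i.
Proof. by rewrite /coord inord_val. Qed.

Lemma continuous_th_inv k : (k <= m)%N ->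
  continuous (fun t : R => (th k (Num.max 0 t))^-1).
Proof.
move=> km t; have t0 : (0 : R) <= Num.max 0 t by rewrite le_max lexx.
have [thc th0] := th_pos_cont km t0.
apply: cvgV; first exact: lt0r_neq0.
apply: (@continuous_comp R R R (Num.max 0) (th k)) => //.
apply: (@continuous_max R R (cst 0) id); first exact: cst_continuous.
exact: cvg_id.
Qed.

Lemma continuous_estimate k : (k <= m)%N ->
  continuous (fun p : R * 'rV[R]_m.+1 * R => estimate p.1.1 p.1.2 p.2 k).
Proof.
elim: k => [_|k IH km] /=.
  by move=> p; apply: cvgZr_tmp; exact: cvg_snd.
have {}IH := IH (ltnW km).
have c1 : continuous (fun p : R * 'rV[R]_m.+1 * R => p.1.1).
  exact: continuous_after (@continuous_fst _ _) (@continuous_fst _ _).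
have c2 : continuous (fun p : R * 'rV[R]_m.+1 * R => p.1.2).
  exact: continuous_after (@continuous_snd _ _) (@continuous_fst _ _).
have cN : continuous (fun p : R * 'rV[R]_m.+1 * R =>
    next_coord F B k p.1.1 (estimate p.1.1 p.1.2 p.2 k)
      ((coord k (estimate p.1.1 p.1.2 p.2 k) - coord k p.1.2) /
       th k (Num.max 0 p.1.1))).
  have cFk : continuous (fun p : R * 'rV[R]_m.+1 => coord k (F p.1 p.2)).
    exact: (continuous_after (@continuous_coord R m k) F_cont).
  apply: (continuous_after (@continuous_partial_inverse R _ _ B
     (unit_row R m k.+1) cFk B_cont B_ge0 (fun t v => F_mono t v km))
     (continuous_pair (continuous_pair c1 IH) _)) => p.
  apply: cvgM; last exact: (continuous_after (continuous_th_inv (ltnW km)) c1).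
  apply: cvgB; first exact: (continuous_after (@continuous_coord R m k) IH).
  exact: (continuous_after (@continuous_coord R m k) c2).
move=> p; apply: cvgD; first exact: IH.
by apply: cvgZr_tmp; exact: cN.
Qed.

Lemma continuous_observer :
  continuous (fun p : R * 'rV[R]_m.+1 * R => observer p.1.1 p.1.2 p.2).
Proof.
apply: continuous_row => j p; have jm : (j <= m)%N by rewrite -ltnS.
have c1 : continuous (fun p : R * 'rV[R]_m.+1 * R => p.1.1).
  exact: continuous_after (@continuous_fst _ _) (@continuous_fst _ _).
have c2 : continuous (fun p : R * 'rV[R]_m.+1 * R => p.1.2).
  exact: continuous_after (@continuous_snd _ _) (@continuous_fst _ _).
apply: cvgM; last exact: (continuous_after (continuous_th_inv jm) c1).
apply: cvgB; last exact: (continuous_after (@continuous_coord R m j) c2).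
exact: (continuous_after (@continuous_coord R m j) (continuous_estimate jm)).
Qed.

Lemma estimate_ext t z z' y k : (forall j, (j < k)%N -> coord j z = coord j z') ->
  estimate t z y k = estimate t z' y k.
Proof.
elim: k => //= k IH zz'; rewrite zz'// IH// => j jk.
by apply: zz'; exact: ltnW.
Qed.

Lemma coord_estimate_gt t z y k j : (k < j <= m)%N ->
  coord j (estimate t z y k) = 0.
Proof.
elim: k => [|k IH] /andP[kj jm] /=.
  by rewrite coordZ coord_unit_row// gtn_eqF// mulr0.
by rewrite coordD coordZ coord_unit_row// gtn_eqF// mulr0 IH ?addr0// jm ltnW.
Qed.

Lemma coord_estimate_0 t z y : coord 0 (estimate t z y 0) = y.
Proof. by rewrite /= coordZ coord_unit_row// mulr1. Qed.

(** The coordinate is a clamped root, hence lies in the box whatever the filters are; this will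
    confine the filters in turn. *)
Lemma coord_estimate_bound t z y k : (0 < k <= m)%N ->
  `|coord k (estimate t z y k)| <= B t.
Proof.
case: k => //= k km; rewrite coordD coordZ coord_unit_row// eqxx mulr1.
by rewrite coord_estimate_gt ?ltnSn// add0r; exact: partial_inverse_bound.
Qed.

(** Estimate [j] reads only the coordinates of [z] below [j], so the observer is a chain of scalar
    linear equations, each with a known forcing term, solved globally one after another. *)
Lemma observer_trajectory_exists s (y : R -> R) : 0 <= s -> continuous y ->
  exists z, trajectory (fun t z => observer t z (y t)) s 0 z.
Proof.
move=> s0 yc.
suff H : forall k, (k <= m.+1)%N -> exists Z : R -> 'rV[R]_m.+1,
    [/\ continuous Z, Z s = 0,
     forall t j, (k <= j <= m)%N -> coord j (Z t) = 0 &
     forall j (t : R), (j < k)%N -> s < t -> is_derive t 1 (fun r => coord j (Z r))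
       ((coord j (estimate t (Z t) (y t) j) - coord j (Z t)) / th j (Num.max 0 t))].
  have [Z [Zc Zs _ dZ]] := H _ (leqnn _); exists Z; split=> //; split.
    exact: continuous_subspaceT.
  move=> t; rewrite interior_itv /= in_itv/= andbT => st.
  apply/is_derive_rowP => i; have := dZ i t (ltn_ord i) st.
  under [fun r => coord i (Z r)]eq_fun do rewrite coord_ord.
  by rewrite /observer mxE.
elim=> [_|k IH km].
  exists (fun=> 0); split=> //; first exact: cst_continuous.
  by move=> t j _; rewrite /coord mxE.
have [Z [Zc Zs Z0 dZ]] := IH (ltnW km).
have ca := continuous_th_inv km.
have cV : continuous (fun t => estimate t (Z t) (y t) k).
  apply: (continuous_after (continuous_estimate km)
    (continuous_pair (continuous_pair _ Zc) yc)) => r; exact: cvg_id.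
have cb : continuous (fun t : R =>
    coord k (estimate t (Z t) (y t) k) / th k (Num.max 0 t)).
  move=> t; apply: cvgM; last exact: ca.
  exact: (continuous_after (@continuous_coord R m k) cV).
have [z zs dz] := linear_ode_exists 0 s0 ca cb.
(* Freezing the solution before [s] makes it continuous on the whole line, as the next equation of
   the chain requires of its data. *)
pose zk t := z (Num.max s t).
have zkc : continuous zk.
  move=> t; apply: (@continuous_comp R R R (Num.max s) z).
    apply: (@continuous_max R R (cst s) id); first exact: cst_continuous.
    exact: cvg_id.
  by apply: (is_derive1_continuous (dz _ _)); rewrite le_max s0.
pose Z' t := Z t + zk t *: unit_row R m k.
have Z'j t j : (j <= m)%N -> j != k -> coord j (Z' t) = coord j (Z t).
  move=> jm jk; rewrite coordD coordZ coord_unit_row// (negPf jk).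
  by rewrite mulr0 addr0.
have Z'k t : coord k (Z' t) = zk t.
  by rewrite coordD coordZ coord_unit_row// eqxx mulr1 Z0 ?leqnn// add0r.
have estE t j : (j <= k)%N -> estimate t (Z' t) (y t) j = estimate t (Z t) (y t) j.
  move=> jk; apply: estimate_ext => i ij; apply: Z'j.
    by rewrite (leq_trans (ltnW ij))// (leq_trans jk).
  by rewrite ltn_eqF// (leq_trans ij).
exists Z'; split.
- move=> t; apply: cvgD; first exact: Zc.
  by apply: cvgZr_tmp; exact: zkc.
- by rewrite /Z' Zs add0r /zk maxxx zs scale0r.
- move=> t j /andP[kj jm]; rewrite Z'j ?gtn_eqF//; apply: Z0.
  by rewrite (ltnW kj).
- move=> j t; rewrite ltnS leq_eqVlt => /predU1P[->|jk] st; last first.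
    have jm : (j <= m)%N by rewrite (leq_trans (ltnW jk)).
    have -> : (fun r => coord j (Z' r)) = (fun r => coord j (Z r)).
      by apply/funext => r; rewrite Z'j// ltn_eqF.
    by rewrite estE ?(ltnW jk)// Z'j ?ltn_eqF//; exact: dZ.
  have -> : (fun r => coord k (Z' r)) = zk by apply/funext => r; exact: Z'k.
  rewrite Z'k estE//.
  have t0 : 0 <= t by rewrite (le_trans s0)// ltW.
  apply: (@near_eq_is_derive _ _ _ z).
    near=> r; rewrite /zk max_r//; apply: ltW; near: r.
    exact: lt_nbhsr.
  apply: (is_derive_eq (dz t t0)).
  by rewrite /zk (max_r (ltW st)) mulrBl; ring.
Unshelve. all: by end_near. Qed.

End observer.

(** * Propagation of the precision along the cascade *)

Section convergence.
Context {R : realType} {m : nat}.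
Variables (F : R -> 'rV[R]_m.+1 -> 'rV[R]_m.+1) (B : R -> R).
Variables (th eta : nat -> R -> R).
Hypothesis B_ge0 : forall t, 0 <= B t.
Hypothesis B_nondec : forall s t, s <= t -> B s <= B t.
Hypothesis stages : forall k, (k <= m)%N -> stage F B k (th k) (eta k) (eta k.+1).

Let est t (z : 'rV[R]_m.+1) y k := estimate F B th t z y k.

(** Estimate [k] has precision [eta k] from time [s + k] on, since each stage consumes a window of
    length one. The last filter therefore needs [m.+1] units of time. *)
Lemma observer_error (s T : R) (x z : R -> 'rV[R]_m.+1) (y : R -> R) :
  0 <= s -> s + m.+1%:R <= T ->
  solution_on `[s, T]%classic F x ->
  (forall t, s <= t <= T -> `|x t| <= B t) ->
  (forall t, s <= t <= T -> y t = coord 0 (x t)) ->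
  solution_on `[s, T]%classic (fun t v => observer F B th t v (y t)) z ->
  z s = 0 ->
  `|z T - x T| <= eta m.+1 T.
Proof.
move=> s0 sT xs xB yx zs z0.
have th0 k t : (k <= m)%N -> s <= t -> 0 < th k t.
  by move=> km st; have [_ _ /(_ t (le_trans s0 st))[]] := stages km.
have dz k (t : R) : (k <= m)%N -> s < t < T -> is_derive t 1 (fun r => coord k (z r))
    ((coord k (est t (z t) (y t) k) - coord k (z t)) / th k t).
  move=> km st; have [_ dz] := zs.
  have /dz/is_derive_rowP/(_ (inord k)) : `[s, T]%classic° t.
    by rewrite interior_itv_bnd /= in_itv.
  rewrite /observer mxE inordK// max_r//.
  by have /andP[/ltW /(le_trans s0)] := st.
have zc k : {within `[s, T], continuous (fun r => coord k (z r))}.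
  by have [/within_continuous_rowP zc _] := zs; exact: zc.
have yB t : s <= t <= T -> `|y t| <= B t.
  by move=> tT; rewrite yx//; apply: le_trans (xB t tT); exact: coord_le_norm_rV.
have estB k t : (k <= m)%N -> s <= t <= T -> `|coord k (est t (z t) (y t) k)| <= B t.
  case: k => [_ tT|k km tT]; first by rewrite /est coord_estimate_0 yB.
  exact: coord_estimate_bound.
(* A filter started at [0] stays within the bound on its input: [linear_ode_bound] with [c = 0]. *)
have zB k t : (k <= m)%N -> s <= t <= T -> `|coord k (z t)| <= B t.
  move=> km /andP[st tT].
  have rT r : s < r < t -> s < r < T by move=> /andP[-> /lt_le_trans]; exact.
  have rT' r : s < r < t -> s <= r <= T by move=> /rT/andP[/ltW-> /ltW->].
  have sub : `[s, t] `<=` `[s, T].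
    by move=> r /=; rewrite !in_itv/= => /andP[-> /le_trans->].
  have := @linear_ode_bound R s t (fun r => coord k (z r)) (fun r => (th k r)^-1)
    (fun r => coord k (est r (z r) (y r) k) / th k r) 0 (B t) st.
  rewrite z0 /coord mxE normr0 mul0r addr0; apply=> //.
  - exact: continuous_subspaceW sub (zc k).
  - by move=> r sr; apply: (is_derive_eq (dz k r km (rT r sr))); rewrite /coord; ring.
  - move=> r sr; have [/andP[sr' rt]] := (sr, rT' r sr) => rT''.
    have := th0 k r km (ltW sr') => tr0.
    rewrite normrM normfV (gtr0_norm tr0) ler_pM2r ?invr_gt0//.
    by rewrite (le_trans (estB k r km (rT' r sr)))// B_nondec// ltW.
  - by move=> r /andP[/ltW sr _]; rewrite invr_ge0 ltW// th0.
have k1 k : s + k.+1%:R = s + k%:R + 1 by rewrite -natr1 addrA.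
have window k t : s + k.+1%:R <= t <= T ->
    [/\ 1 <= t, `[t - 1, t] `<=` `[s, T] &
     forall r, t - 1 <= r <= t -> (s + k%:R <= r <= T) && (s <= r <= T)].
  have := ler0n R k => kn0; rewrite k1 => /andP[skt tT]; split; first lra.
    by move=> r /=; rewrite !in_itv/= => /andP[? ?]; apply/andP; split; lra.
  by move=> r /andP[? ?]; apply/andP; split; apply/andP; split; lra.
have stageP k t : (k <= m)%N -> s + k.+1%:R <= t <= T ->
    (forall r, s + k%:R <= r <= T ->
       `|est r (z r) (y r) k - head k.+1 (x r)| <= eta k r) ->
    `|coord k (z t) - coord k (x t)| <= eta k.+1 t /\
    ((k < m)%N -> `|est t (z t) (y t) k.+1 - head k.+2 (x t)| <= eta k.+1 t).
  move=> km ktT estk; have [t1 sub win] := window k t ktT.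
  have [_ _ _ stP] := stages km.
  have t0 : 0 <= t by lra.
  rewrite /est /= (max_r t0).
  apply: (stP t x (fun r => coord k (z r)) (fun r => est r (z r) (y r) k) t1) => //.
  - exact: solution_onS sub xs.
  - by move=> r /win/andP[_]; exact: xB.
  - exact: continuous_subspaceW sub (zc k).
  - move=> r /andP[tr rt]; apply: dz => //.
    have /win/andP[_ /andP[h _]] : t - 1 <= t - 1 <= t by rewrite lexx; lra.
    have /andP[_ h2] := ktT.
    by rewrite (le_lt_trans h tr) (lt_le_trans rt).
  - by move=> r /win/andP[_]; exact: zB.
  - by move=> r /win/andP[h _]; exact: estk.
have estP k : (k <= m)%N -> forall t, s + k%:R <= t <= T ->
    `|est t (z t) (y t) k - head k.+1 (x t)| <= eta k t.
  elim: k => [_ t|k IH km t ktT].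
    (* At stage 0 the estimate is the output itself, with zero error. *)
    rewrite addr0 => tT; rewrite head_succ// head_0 add0r /est /= yx// subrr normr0.
    by have [[eta0 _] _ _ _] := stages (leq0n m); exact: ltW.
  have [_ /(_ km)] := stageP k t (ltnW km) ktT (IH (ltnW km)).
  exact.
(* Precisions coarsen along the stages, so the last one bounds the errors of all coordinates. *)
have eta_le k j : (k + j <= m)%N -> eta k.+1 T <= eta (k + j).+1 T.
  elim: j => [|j IH]; first by rewrite addn0.
  rewrite addnS => kjm; apply: le_trans (IH (ltnW kjm)) _.
  by have [_ + _ _] := stages kjm; exact.
apply: row_norm_le => [|i].
  by have [[eta0 _] + _ _] := stages (leqnn m) => /(_ T); apply: le_trans; exact: ltW.
have im : (i <= m)%N by rewrite -ltnS.
have iT : s + i.+1%:R <= T <= T.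
  by rewrite lexx andbT (le_trans _ sT)// lerD2l ler_nat.
rewrite !mxE -!coord_ord; have [h _] := stageP i T im iT (estP i im).
by apply: le_trans h _; have := eta_le i (m - i)%N; rewrite subnKC//; exact.
Qed.

End convergence.

(** * Triangular systems *)

Section triangular.
Context {R : realType} {m : nat}.
Variables (f : forall i : 'I_m, R -> 'rV[R]_(i.+1 + 1) -> R).
Variable fn : R -> 'rV[R]_m.+1 -> R.
Hypothesis f_cont : forall i : 'I_m, jointly_continuous (@f i).
Hypothesis fn_cont : jointly_continuous fn.
Hypothesis f_mono : forall (i : 'I_m) (t : R) (x : 'rV[R]_i.+1), 0 <= t ->
  strictly_monotone (fun z : R => @f i t (row_mx x (const_mx z))).

(** Freezing the field at negative times makes it continuous on the whole space, as the cascade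
    assumes. *)
Let F (t : R) (x : 'rV[R]_m.+1) := triangular_field (@f) fn (Num.max 0 t) x.

Lemma coord_triangular_field (j : 'I_m) t x :
  coord j (triangular_field (@f) fn t x) = @f j t (head_coords j x).
Proof. by rewrite /coord mxE inordK ?valK// ltnW// ltnS. Qed.

Lemma continuous_head_coords (j : 'I_m) : continuous (@head_coords R m j).
Proof. by apply: continuous_row => i; exact: coord_continuous. Qed.

Lemma continuous_triangular_field :
  continuous (fun p : R * 'rV[R]_m.+1 => F p.1 p.2).
Proof.
have cmax : continuous (fun p : R * 'rV[R]_m.+1 => Num.max 0 p.1).
  move=> p; apply: (@continuous_max R _ (cst 0) fst); first exact: cst_continuous.
  exact: cvg_fst.
apply: continuous_row => i; case: insub => [j|].
  apply: (continuous_comp_within (@f_cont j) (continuous_pair cmax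
    (continuous_after (@continuous_head_coords j) (@continuous_snd _ _)))) => p.
  by rewrite /= le_max lexx.
apply: (continuous_comp_within fn_cont (continuous_pair cmax (@continuous_snd _ _))) => p.
by rewrite /= le_max lexx.
Qed.

Lemma triangular_field_head k t x : (k < m)%N ->
  coord k (F t (head k.+2 x)) = coord k (F t x).
Proof.
move=> km; have := coord_triangular_field (Ordinal km); rewrite /= => E.
rewrite /F !E; congr (@f _ _ _); apply/rowP => i; rewrite !mxE /=.
by have -> : (i < k.+2)%N by rewrite (leq_trans (ltn_ord i))//= addn1.
Qed.

Lemma triangular_field_mono k t v : (k < m)%N ->
  strictly_monotone (fun a => coord k (F t (v + a *: unit_row R m k.+1))).
Proof.
move=> km; have := coord_triangular_field (Ordinal km); rewrite /= => E.
have t0 : 0 <= Num.max 0 t by rewrite le_max lexx.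
pose u : 'rV[R]_k.+1 := \row_i coord i v.
(* Moving along [unit_row R m k.+1] translates only the last argument of the [k]-th component, so
   its strict monotonicity carries over. *)
have headE a : head_coords (Ordinal km) (v + a *: unit_row R m k.+1) =
    row_mx u (const_mx (coord k.+1 v + a)).
  apply/rowP => i; rewrite !mxE; case: splitP => j ij; rewrite mxE.
    have jk : (j <= k)%N by rewrite -ltnS.
    rewrite /= ij ltn_eqF ?ltnS// mulr0 addr0 /coord; congr (v _ _).
    by apply: val_inj; rewrite /= inordK ?ij// ltnS (leq_trans jk)// ltnW.
  rewrite ord1 addn0 in ij; rewrite /= ij eqxx mulr1 /coord; congr (v _ _ + _).
  by apply: val_inj; rewrite /= inordK.
have Eh a : coord k (F t (v + a *: unit_row R m k.+1)) =
    @f (Ordinal km) (Num.max 0 t) (row_mx u (const_mx (coord k.+1 v + a))).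
  by rewrite /F E headE.
have [mon|mon] := @f_mono (Ordinal km) _ u t0; [left|right] => a b ab; rewrite !Eh;
  by apply: mon; rewrite ltrD2l.
Qed.

(** The box is [beta] at radius [r]: monotonicity in the second variable covers the whole ball. It
    does not depend on [t0], so one map [G] serves all initial times and all starting times [s] of
    the observer. *)
Lemma observer_exists (beta : R -> R -> R) (r : R) (delta : R -> R) :
  classNN beta ->
  (forall t0 x0 x, 0 <= t0 -> trajectory (triangular_field (@f) fn) t0 x0 x ->
     forall t, t0 <= t -> enorm (x t) <= beta t (enorm x0)) ->
  0 <= r -> pos_noninc delta ->
  exists G : R -> 'rV[R]_m.+1 -> R -> 'rV[R]_m.+1,
  [/\ continuous (fun p : R * 'rV[R]_m.+1 * R => G p.1.1 p.1.2 p.2),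
    forall s y, 0 <= s -> continuous y ->
      exists z, trajectory (fun t v => G t v (y t)) s 0 z &
    forall t0 s T x0 x y z, 0 <= t0 -> t0 <= s -> s + m.+1%:R <= T ->
      enorm x0 <= r -> trajectory (triangular_field (@f) fn) t0 x0 x ->
      (forall t, t0 <= t -> y t = coord 0 (x t)) ->
      solution_on `[s, T]%classic (fun t v => G t v (y t)) z -> z s = 0 ->
      `|z T - x T| <= delta T].
Proof.
move=> [bc bN1 bN2] xbeta r0 dP.
have max0 t : (0 : R) <= Num.max 0 t by rewrite le_max lexx.
pose B t := beta (Num.max 0 t) r.
have Bc : continuous B.
  have cc : continuous (fun t : R => (Num.max 0 t, r)).
    apply: continuous_pair; last exact: cst_continuous.
    move=> t; apply: (@continuous_max R R (cst 0) id); first exact: cst_continuous.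
    exact: cvg_id.
  by apply: (continuous_comp_within bc cc) => t /=.
have B0 t : 0 <= B t by have [_ + _] := bN1 r r0; exact.
have Bn s t : s <= t -> B s <= B t.
  move=> st; have [_ _ +] := bN1 r r0; apply=> //.
  by rewrite ge_max !le_max lexx st orbT.
have Fc := continuous_triangular_field.
have [th [eta [etam st]]] := stages_exist Fc Bc B0 Bn triangular_field_head
  triangular_field_mono dP.
have th0 k (t : R) : (k <= m)%N -> 0 <= t -> {for t, continuous (th k)} /\ 0 < th k t.
  by move=> km; have [_ _ + _] := st k km; exact.
exists (observer F B th); split.
- exact: (continuous_observer Fc Bc B0 triangular_field_mono th0).
- by move=> s y; exact: (observer_trajectory_exists Fc Bc B0 triangular_field_mono th0).
move=> t0 s T x0 x y z t00 t0s sT xr xt yx zs z0.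
have [xs _] := xt.
rewrite -etam; apply: (observer_error B0 Bn st _ sT _ _ _ zs z0).
- exact: le_trans t0s.
- have sub : `[s, T] `<=` `[t0, +oo[.
    by move=> t /=; rewrite !in_itv/= andbT => /andP[/(le_trans t0s)].
  have [xc dx] := solution_onS sub xs; split=> // t st'.
  rewrite /F max_r; first exact: dx.
  move: st'; rewrite interior_itv /= in_itv/= => /andP[/ltW + _].
  by apply: le_trans; exact: le_trans t0s.
- move=> t /andP[st' _]; have t0t := le_trans t0s st'.
  apply: le_trans (norm_le_enorm _) _; apply: le_trans (xbeta _ _ _ t00 xt t t0t) _.
  rewrite /B max_r ?(le_trans t00)//.
  have [_ _ +] := bN2 t (le_trans t00 t0t); apply=> //; exact: sqrtr_ge0.
- by move=> t /andP[st' _]; apply: yx; exact: le_trans st'.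
Qed.

End triangular.

(** * From precision to convergence *)

Section assembly.
Context {R : realType}.

Lemma solution_on_eq n (D : set R) (F F' : R -> 'rV[R]_n -> 'rV[R]_n) x :
  (forall t v, D t -> F t v = F' t v) ->
  solution_on D F x -> solution_on D F' x.
Proof.
move=> FF' [xc dx]; split=> // t Dt; rewrite -FF'; first exact: dx.
exact: interior_subset.
Qed.

(** The precision prescribed after the last stage; it tends to zero, which turns the error bound
    into convergence. *)
Let delta (t : R) := (1 + Num.max 0 t)^-1.

Let delta_den (t : R) : 0 < 1 + Num.max 0 t.
Proof. by rewrite ltr_wpDr// le_max lexx. Qed.

Lemma pos_noninc_inverse : pos_noninc delta.
Proof.
split=> [t|s t st]; first by rewrite invr_gt0.
by rewrite lef_pV2 ?posrE// lerD2l ge_max !le_max lexx st orbT.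
Qed.

Lemma cvg0_of_norm_le_inverse (V : normedModType R) (e : R -> V) T0 :
  (forall t, T0 <= t -> `|e t| <= delta t) -> e t @[t --> +oo] --> (0 : V).
Proof.
move=> eT; apply/cvgrPdist_le => eps eps0; near=> t.
rewrite sub0r normrN; apply: le_trans (eT t _) _.
  by near: t; exact: nbhs_pinfty_ge (num_real _).
rewrite -[leRHS]invrK lef_pV2 ?posrE ?invr_gt0//.
have : eps^-1 <= t by near: t; exact: nbhs_pinfty_ge (num_real _).
have : t <= Num.max 0 t by rewrite le_max lexx orbT.
lra.
Unshelve. all: by end_near. Qed.

(** Outputs are constrained only from [t0] on, whereas observer trajectories are built from inputs
    continuous on the whole line; a constant extension to the left bridges the gap. *)
Lemma output_extension m (F : R -> 'rV[R]_m.+1 -> 'rV[R]_m.+1) t0 x0 x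
    (y : R -> 'rV[R]_1) :
  trajectory F t0 x0 x -> output_of (@first_coord R m) t0 x y ->
  (forall t, t0 <= t -> y t ord0 ord0 = coord 0 (x t)) /\
  exists2 yc : R -> R, continuous yc & forall t, t0 <= t -> yc t = y t ord0 ord0.
Proof.
move=> [[/within_continuous_rowP xc _] _] yx.
have yE t : t0 <= t -> y t ord0 ord0 = coord 0 (x t).
  by move=> t0t; rewrite yx// mxE -(coord_ord (x t) ord0).
split=> //; exists (fun t => coord 0 (x (Num.max t0 t))).
  exact: (continuous_clamp_infty (xc (inord 0))).
by move=> t t0t; rewrite max_r// yE.
Qed.

Lemma observer_continuousT m (D : set R)
    (G : R -> 'rV[R]_m.+1 -> R -> 'rV[R]_m.+1) :
  continuous (fun p : R * 'rV[R]_m.+1 * R => G p.1.1 p.1.2 p.2) ->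
  observer_continuous D (fun t v (w : 'rV[R]_1) => G t v (w ord0 ord0)).
Proof.
move=> Gc; apply: continuous_subspaceT.
apply: (continuous_after Gc (f := fun q : R * 'rV[R]_m.+1 * 'rV[R]_1 =>
  (q.1.1, q.1.2, q.2 ord0 ord0))).
apply: continuous_pair.
  apply: continuous_pair.
    exact: continuous_after (@continuous_fst _ _) (@continuous_fst _ _).
  exact: continuous_after (@continuous_snd _ _) (@continuous_fst _ _).
exact: (continuous_after (@coord_continuous R 1 1 ord0 ord0) (@continuous_snd _ _)).
Qed.

End assembly.

(** * Solvability of the two design problems *)

Section solvability.
Context {R : realType} {m : nat}.
Variable F : R -> 'rV[R]_m.+1 -> 'rV[R]_m.+1.
Hypothesis observers : forall (r : R) (delta : R -> R), 0 <= r -> pos_noninc delta ->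
  exists G : R -> 'rV[R]_m.+1 -> R -> 'rV[R]_m.+1,
  [/\ continuous (fun p : R * 'rV[R]_m.+1 * R => G p.1.1 p.1.2 p.2),
    forall s y, 0 <= s -> continuous y ->
      exists z, trajectory (fun t v => G t v (y t)) s 0 z &
    forall t0 s T x0 x y z, 0 <= t0 -> t0 <= s -> s + m.+1%:R <= T ->
      enorm x0 <= r -> trajectory F t0 x0 x ->
      (forall t, t0 <= t -> y t = coord 0 (x t)) ->
      solution_on `[s, T]%classic (fun t v => G t v (y t)) z -> z s = 0 ->
      `|z T - x T| <= delta T].

Lemma ODP_eball (r : R) : 0 <= r -> ODP F (@first_coord R m) (@eball R m.+1 r).
Proof.
move=> r0 t0 t00; have [G [Gc Gex Gerr]] := observers r0 (@pos_noninc_inverse R).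
exists (fun t v w => G t v (w ord0 ord0)), [set 0]; split.
- exact: observer_continuousT.
- by exists 0.
move=> _ y -> [x0 [x [x0r xt yx]]] obs; split.
  have [yE [yc ycc ycE]] := output_extension xt yx.
  have [z [zs z0]] := Gex t0 yc t00 ycc; exists z; split=> //.
  apply: solution_on_eq zs => t v; rewrite /= in_itv/= andbT => /ycE.
  by rewrite /obs => ->.
(* Convergence is asked for every trajectory from the ball with output [y], not only the one that
   produced it; [Gerr] covers them all. *)
move=> z [zs z0] x0' x' x0r' xt' yx'.
have [yE' _] := output_extension xt' yx'.
apply: (@cvg0_of_norm_le_inverse _ _ _ (t0 + m.+1%:R)) => t tT.
rewrite distrC; apply: (Gerr t0 t0 t x0' x' (fun t => y t ord0 ord0) z) => //.
by apply: solution_onS zs => s /=; rewrite !in_itv/= andbT => /andP[].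
Qed.

Lemma SODP_setT : SODP F (@first_coord R m) [set: 'rV[R]_m.+1].
Proof.
move=> t0 t00.
have [G GP] := choice (fun k : nat => observers (ler0n R k) (@pos_noninc_inverse R)).
pose c : R := m.+1%:R; have c0 : 0 < c by rewrite ltr0n.
(* The spacing [c] is the time an observer needs to become accurate: the [k]-th one warms up on the
   first half of its interval and is read on the second. The predecessor makes
   [tau 0 = tau 1 = t0]. *)
pose tau (k : nat) := t0 + k.-1%:R * c.
have tau0 k : t0 <= tau k by rewrite lerDl mulr_ge0// ltW.
have tauS k : (1 <= k)%N -> tau k.+1 = tau k + c.
  by case: k => // k _; rewrite /tau/= -natr1 mulrDl mul1r addrA.
exists tau, (fun k t v w => G k t v (w ord0 ord0)), [set 0] => D; split.
- split; rewrite /tau /= ?mul0r ?addr0//.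
    by move=> k k1; rewrite -/(tau k.+1) -/(tau k) tauS// ltrDl.
  apply/cvgryPge => A; near=> k.
  have : (Num.truncn (`|A| / c)).+1%:R <= (k.-1%:R : R).
    rewrite ler_nat -ltnS (@ltn_predK 0); last by near: k; exists 1%N.
    by near: k; exists (Num.truncn (`|A| / c)).+2.
  have := truncnS_gt (`|A| / c) => h1 h2.
  have : `|A| / c <= k.-1%:R by exact: le_trans (ltW h1) h2.
  by rewrite ler_pdivrMr//; have := ler_norm A; lra.
- by move=> k _; have [Gc _ _] := GP k; exact: observer_continuousT.
- by exists 0.
move=> y [x0 [x [_ xt yx]]] obs; split.
  move=> k _ k1 ->; have [yE [yc ycc ycE]] := output_extension xt yx.
  have [_ Gex _] := GP k.
  have [z [zs z0]] := Gex (tau k.-1) yc (le_trans t00 (tau0 _)) ycc.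
  exists z => //; apply: (@solution_on_eq R m.+1 _ (fun t v => G k t v (yc t))).
    move=> t v; rewrite /D /= in_itv/= => /andP[/(le_trans (tau0 _))/ycE + _].
    by rewrite /obs => ->.
  by apply: solution_onS zs => t; rewrite /D /= !in_itv/= andbT => /andP[].
move=> z zP Z Zz x0' x' _ xt' yx'.
have [yE' _] := output_extension xt' yx'.
(* From index [K] on, the radius exceeds the norm of the initial state. Also [K >= 2], which
   excludes the first observer, the only one read without a warm-up. *)
pose K := (Num.truncn (enorm x0')).+2.
apply: (@cvg0_of_norm_le_inverse _ _ _ (tau K)) => t tauKt.
have t0t : t0 <= t by exact: le_trans tauKt.
(* The index of the switching interval that contains [t]. *)
pose k := (Num.truncn ((t - t0) / c)).+1.
have kt : tau k <= t < tau k.+1.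
  have := @truncn_itv R ((t - t0) / c); rewrite divr_ge0 ?subr_ge0 ?(ltW c0)//.
  rewrite ler_pdivlMr// ltr_pdivrMr// /tau /k /= => /(_ isT)/andP[kl ku].
  by rewrite -lerBrDl -ltrBlDl kl ku.
have Kk : (K <= k)%N.
  have : tau K < tau k.+1 by case/andP: kt => _; exact: le_lt_trans.
  by rewrite /tau ltrD2l ltr_pM2r// ltr_nat /= ltnS.
have k1 : (1 <= k.-1)%N by rewrite -ltnS (leq_trans _ Kk).
have k1' : (1 <= k)%N by [].
have tauk : tau k = tau k.-1 + c by rewrite -tauS// prednK.
have [zs z0] := zP k k1'; have [_ _ Gerr] := GP k.
rewrite (Zz k t k1' kt) distrC.
have /andP[tkt ttk] := kt.
apply: (Gerr t0 (tau k.-1) t x0' x' (fun t => y t ord0 ord0) (z k)) => //.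
- by rewrite -tauk.
- apply: (@le_trans _ _ K%:R); last by rewrite ler_nat.
  by apply: (le_trans (ltW (truncnS_gt _))); rewrite ler_nat.
- apply: solution_onS zs => s; rewrite /D /= !in_itv/= => /andP[-> /le_trans]; apply.
  exact: ltW.
Unshelve. all: by end_near. Qed.

End solvability.

Theorem theorem1p1 (R : realType) (m : nat)
    (f : forall i : 'I_m, R -> 'rV[R]_(i.+1 + 1) -> R)
    (fn : R -> 'rV[R]_m.+1 -> R)
    (f_cont : forall i : 'I_m, jointly_continuous (f i))
    (f_lip : forall i : 'I_m, locally_lipschitz_state (f i))
    (fn_cont : jointly_continuous fn)
    (fn_lip : locally_lipschitz_state fn)
    (f_mono : forall (i : 'I_m) (t : R) (x : 'rV[R]_i.+1), 0 <= t ->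
       strictly_monotone (fun z : R => f i t (row_mx x (const_mx z))))
    (complete : forward_complete (triangular_field f fn)) :
  SODP (triangular_field f fn) (@first_coord R m) [set: 'rV[R]_m.+1] /\
  (forall r : R, 0 < r ->
     ODP (triangular_field f fn) (@first_coord R m) (@eball R m.+1 r)).
Proof.
case: complete => beta bN xbeta.
have observers r delta := observer_exists f_cont fn_cont f_mono
  (r := r) (delta := delta) bN (fun t0 x0 x t00 => (xbeta t0 x0 t00).2 x).
split; first exact: SODP_setT.
by move=> r r0; apply: ODP_eball => //; exact: ltW.
Qed.
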